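(* For every $n\ge 1$, Thompson's group $F$ is not almost convex with respect to the generating set $X_n=\{x_0,x_1,\dots,x_n\}$.
   Context: Thompson's group is $F=\langle x_k,\ k\ge 0\mid x_i^{-1}x_jx_i=x_{j+1}\text{ if } i<j\rangle$; for $n\ge 1$ the set $X_n=\{x_0,\dots,x_n\}$ generates $F$. Let $G$ be a group with finite generating set $X$ and word metric $d_X$ (the path metric on the Cayley graph, in which $h$ and $hx^{\pm1}$, $x\in X$, are joined by an edge). $G$ is almost convex$(k)$, or $AC(k)$, with respect to $X$ if there is a constant $L(k)$ such that for every positive integer $m$, any two elements $x,y$ in the ball of radius $m$ centered at the identity with $d_X(x,y)\le k$ can be connected by a path in the Cayley graph of length at most $L(k)$ that lies completely within this ball. $G$ is almost convex with respect to $X$ if it is $AC(2)$ with respect to $X$ (equivalently, by a result of Cannon, $AC(k)$ for all $k\ge 2$). *)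

(* Defs.v *)
From HB Require Import structures.
From mathcomp Require Import all_boot.
From mathcomp Require Import boolp.

Set Implicit Arguments.
Unset Strict Implicit.
Unset Printing Implicit Defensive.

Local Open Scope quotient_scope.
Local Open Scope group_scope.

Section Words.
Variable I : Type.

(* The letter (i, false) stands for the generator x_i, (i, true) for x_i^-1. *)
Definition letter := (I * bool)%type.
Definition word := seq letter.

Definition linv (a : letter) : letter := (a.1, ~~ a.2).
Definition winv (w : word) : word := rev (map linv w).

(* [R u v] reads as the defining relation "u = v"; the group presented by the  *)
(* generators I and the relations R is the quotient of the monoid of words by  *)
(* the least congruence containing R and the free cancellations.               *)
Inductive pres_eq (R : word -> word -> Prop) : word -> word -> Prop :=
| pres_refl u : pres_eq R u u
| pres_sym u v : pres_eq R u v -> pres_eq R v u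
| pres_trans v u w : pres_eq R u v -> pres_eq R v w -> pres_eq R u w
| pres_cat u u' v v' :
    pres_eq R u u' -> pres_eq R v v' -> pres_eq R (u ++ v) (u' ++ v')
| pres_cancel a : pres_eq R [:: a; linv a] [::]
| pres_rel u v : R u v -> pres_eq R u v.

End Words.

Section Presentation.
Variable I : choiceType.
Variable R : word I -> word I -> Prop.

Definition pres_eqb (u v : word I) : bool := `[< pres_eq R u v >].

Fact pres_eqb_refl : reflexive pres_eqb.
Proof. by move=> u; apply/asboolP; apply: pres_refl. Qed.

Fact pres_eqb_sym : symmetric pres_eqb.
Proof. by move=> u v; apply/asboolP/asboolP; apply: pres_sym. Qed.

Fact pres_eqb_trans : transitive pres_eqb.
Proof.
move=> v u w /asboolP uv /asboolP vw.
by apply/asboolP; apply: pres_trans uv vw.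
Qed.

Canonical pres_equiv :=
  EquivRel pres_eqb pres_eqb_refl pres_eqb_sym pres_eqb_trans.

Definition presented : Type := {eq_quot pres_equiv}.
HB.instance Definition _ := Choice.copy presented {eq_quot pres_equiv}.

Definition pres_class (w : word I) : presented := \pi_({eq_quot pres_equiv}) w.
Definition pres_word (g : presented) : word I :=
  repr (g : {eq_quot pres_equiv}).

Lemma pres_classP u v : pres_class u = pres_class v <-> pres_eq R u v.
Proof.
split=> [/eqmodP/asboolP // | uv].
by apply/eqmodP/asboolP.
Qed.

Lemma pres_wordK : cancel pres_word pres_class.
Proof. exact: reprK. Qed.

Lemma pres_class_wordK w : pres_eq R (pres_word (pres_class w)) w.
Proof. by apply/pres_classP; rewrite pres_wordK. Qed.

Lemma linvK : involutive (@linv I).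
Proof. by case=> i b; rewrite /linv /= negbK. Qed.

Lemma winvK : involutive (@winv I).
Proof. by move=> w; rewrite /winv map_rev revK mapK //; apply: linvK. Qed.

Lemma pres_catwV w : pres_eq R (w ++ winv w) [::].
Proof.
elim: w => [|a w IHw]; first exact: pres_refl.
rewrite /winv /= rev_cons -cats1 catA -cat1s.
apply: pres_trans (pres_cancel R a).
apply: (@pres_cat I R [:: a] [:: a] _ [:: linv a]); first exact: pres_refl.
rewrite -[X in pres_eq _ _ X]cat0s.
by apply: pres_cat; [exact: IHw | exact: pres_refl].
Qed.

Lemma pres_catVw w : pres_eq R (winv w ++ w) [::].
Proof. by rewrite -{2}[w]winvK; apply: pres_catwV. Qed.

Lemma pres_winv u v : pres_eq R u v -> pres_eq R (winv u) (winv v).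
Proof.
move=> uv; apply: (@pres_trans I R (winv u ++ v ++ winv v)).
  rewrite -[X in pres_eq _ X]cats0; apply: pres_cat; first exact: pres_refl.
  exact/pres_sym/pres_catwV.
rewrite catA -[X in pres_eq _ _ X]cat0s.
apply: pres_cat; last exact: pres_refl.
apply: pres_trans (pres_catVw u).
by apply: pres_cat; [exact: pres_refl | exact: pres_sym].
Qed.

Definition pres_one : presented := pres_class [::].
Definition pres_inv (g : presented) : presented :=
  pres_class (winv (pres_word g)).
Definition pres_mul (g h : presented) : presented :=
  pres_class (pres_word g ++ pres_word h).

Lemma pres_mulE u v :
  pres_mul (pres_class u) (pres_class v) = pres_class (u ++ v).
Proof. by apply/pres_classP/pres_cat; apply: pres_class_wordK. Qed.

Lemma pres_invE u : pres_inv (pres_class u) = pres_class (winv u).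
Proof. by apply/pres_classP/pres_winv/pres_class_wordK. Qed.

Fact pres_mulA : associative pres_mul.
Proof.
move=> x y z; rewrite -(pres_wordK x) -(pres_wordK y) -(pres_wordK z).
by rewrite !pres_mulE catA.
Qed.

Fact pres_mul1 : left_id pres_one pres_mul.
Proof. by move=> x; rewrite -(pres_wordK x) pres_mulE. Qed.

Fact pres_mulr1 : right_id pres_one pres_mul.
Proof. by move=> x; rewrite -(pres_wordK x) pres_mulE cats0. Qed.

Fact pres_mulV : left_inverse pres_one pres_inv pres_mul.
Proof.
move=> x; rewrite -(pres_wordK x) pres_invE pres_mulE.
exact/pres_classP/pres_catVw.
Qed.

Fact pres_mulrV : right_inverse pres_one pres_inv pres_mul.
Proof.
move=> x; rewrite -(pres_wordK x) pres_invE pres_mulE.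
exact/pres_classP/pres_catwV.
Qed.

HB.instance Definition _ := isGroup.Build presented
  pres_mulA pres_mul1 pres_mulr1 pres_mulV pres_mulrV.

Lemma pres_classM u v : pres_class u * pres_class v = pres_class (u ++ v).
Proof. exact: pres_mulE. Qed.

Lemma pres_classV u : (pres_class u)^-1 = pres_class (winv u).
Proof. exact: pres_invE. Qed.

Definition pres_gen (i : I) : presented := pres_class [:: (i, false)].

End Presentation.

Section AlmostConvex.
Variable G : groupType.

Definition generates (X : seq G) : Prop :=
  forall g : G, exists2 s : seq G,
    all (fun y => (y \in X) || (y^-1 \in X)) s & g = \prod_(y <- s) y.

Record finGenSet := FinGenSet { gset :> seq G; gset_gen : generates gset }.

Variable X : finGenSet.

Definition cayley_edge : rel G :=
  fun h g => has (fun x => (g == h * x) || (g == h * x^-1)) X.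

(* As in path.v, a path from g to h is g followed by a sequence p with        *)
(* last g p = h; its length is size p.                                        *)
Definition has_path_of_length (g h : G) (n : nat) : Prop :=
  exists p : seq G, [/\ path cayley_edge g p, last g p = h & size p = n].

Lemma cayley_connected (g h : G) : exists n, `[< has_path_of_length g h n >].
Proof.
have [s sX defh] := gset_gen X (g^-1 * h).
have {defh}-> : h = g * \prod_(y <- s) y by rewrite -defh mulVKg.
suff [p gp lp] : exists2 p, path cayley_edge g p &
    last g p = g * \prod_(y <- s) y.
  by exists (size p); apply/asboolP; exists p.
elim: s g sX => [|y s IHs] g /=.
  by exists [::] => //=; rewrite big_nil mulg1.
case/andP=> yX sX; have [p gp lp] := IHs (g * y) sX.
exists (g * y :: p) => /=; last by rewrite lp big_cons mulgA.
rewrite gp andbT; apply/hasP; case/orP: yX => yX.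
  by exists y => //; rewrite eqxx.
by exists y^-1 => //; rewrite invgK eqxx orbT.
Qed.

Definition word_dist (g h : G) : nat := ex_minn (cayley_connected g h).

Definition in_ball (m : nat) (g : G) : bool := (word_dist 1 g <= m)%N.

(* For a path, lying in the ball means that all of its vertices do.           *)
Definition AC (k : nat) : Prop :=
  exists L : nat, forall m : nat, (0 < m)%N ->
  forall x y : G, in_ball m x -> in_ball m y -> (word_dist x y <= k)%N ->
  exists p : seq G, [/\ path cayley_edge x p, last x p = y, (size p <= L)%N
                      & all (in_ball m) (x :: p)].

Definition almost_convex : Prop := AC 2.

End AlmostConvex.

Inductive thompson_rel : word nat -> word nat -> Prop :=
| ThompsonRel (i j : nat) : (i < j)%N ->
    thompson_rel [:: (i, true); (j, false); (i, false)] [:: (j.+1, false)].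

Definition thompsonF : groupType := presented thompson_rel.

Definition tx (k : nat) : thompsonF := pres_gen thompson_rel k.

Lemma tx_rel (i j : nat) : (i < j)%N -> (tx i)^-1 * tx j * tx i = tx j.+1.
Proof.
move=> ij; rewrite /tx /pres_gen pres_classV.
rewrite (pres_classM _ (winv [:: (i, false)])) pres_classM.
exact/pres_classP/pres_rel/(ThompsonRel ij).
Qed.

Definition Xseq (n : nat) : seq thompsonF := [seq tx k | k <- iota 0 n.+1].

Lemma Xseq_generates (n : nat) : (0 < n)%N -> generates (Xseq n).
Proof.
move=> n_gt0.
pose ok (y : thompsonF) := (y \in Xseq n) || (y^-1 \in Xseq n).
pose gen g := exists2 s : seq thompsonF, all ok s & g = \prod_(y <- s) y.
have gen1 : gen 1 by exists [::]; rewrite ?big_nil.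
have genM g h : gen g -> gen h -> gen (g * h).
  move=> [s sX ->] [t tX ->]; exists (s ++ t); rewrite ?big_cat //.
  by rewrite all_cat sX.
have genV g : gen g -> gen g^-1.
  case=> s sX ->; elim: s sX => [|y s IHs] /=; first by rewrite big_nil invg1.
  case/andP=> yX sX; rewrite big_cons invgM; apply: genM; first exact: IHs.
  exists [:: y^-1]; last by rewrite big_seq1.
  by rewrite /= /ok invgK orbC andbT.
have genX k : (k <= n)%N -> gen (tx k).
  move=> kn; exists [:: tx k]; last by rewrite big_seq1.
  by rewrite /= andbT /ok map_f // mem_iota.
have gen_tx k : gen (tx k).
  elim: k => [|[|k] IHk]; [exact: genX | exact: genX |].
  rewrite -(tx_rel (ltn0Sn k)).
  exact: (genM _ _ (genM _ _ (genV _ (genX 0 isT)) IHk) (genX 0 isT)).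
suff genw w : gen (pres_class thompson_rel w).
  by move=> g; rewrite -(pres_wordK g); apply: genw.
elim: w => [|[i b] w IHw]; first exact: gen1.
rewrite -cat1s -pres_classM; apply: genM => //.
case: b; last exact: gen_tx.
by rewrite -(pres_classV _ [:: (i, false)]); apply: genV; apply: gen_tx.
Qed.

Definition X_ (n : nat) (n_gt0 : (0 < n)%N) : finGenSet thompsonF :=
  FinGenSet (Xseq_generates n_gt0).

(* Main.v *)
Require Import Defs.
From mathcomp Require Import all_boot.
From mathcomp Require Import all_order all_algebra.
From mathcomp Require Import boolp.
From mathcomp Require Import zify ring lra.

Set Implicit Arguments.
Unset Strict Implicit.
Unset Printing Implicit Defensive.

Import Order.TTheory GRing.Theory Num.Theory.
Local Open Scope ring_scope.

(** The proof exhibits, for each candidate constant L, two elements x and y of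
    the same ball of radius m with y = x x_0^-2, such that every path of length
    at most L from x to y leaves the ball.

    F acts on the half-line, x_i cutting the unit interval [i, i + 1] into two
    unit intervals. A point is exposed when its position is a natural number
    and covered otherwise. Each letter flips the state of at most one point
    (flip_ptP), so a word is at least as long as the total number of flips of
    any family of distinct points (flips_count).

    To reach an element close to x, two tasks have to be performed. The left
    one rearranges two carets close to 0: to do it, all the points to the right
    of these have to leave the left spine. The right one covers a far
    point z: as only the first n + 1 exposed points are within reach of the
    generators, almost all the marked points before z have to be covered then
    (near_right_or_left_first). A word can do the right task first or the left
    task first, and the final position of every marked point bounds its flips
    from below in each of the two cases (right_first_bound, left_first_bound).
    The sum of the two bounds is at least 2 m + 2 for all the elements at
    distance at most L from x (ridge). Now x is reached in m letters by doing
    the right task first, and y by doing the left task first. Were there a short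
    path from x to y in the ball, some element on it would be reached in at most
    m letters in the first order, and a neighbour of it in at most m letters in
    the second order, so the element itself in at most m + 1 letters in the
    second order: the sum would be at most 2 m + 1.

    The delicate point is that for n > 1 the generators x_1, .., x_n can cover
    an exposed point between the two tasks, which would be profitable in both
    orders. This is prevented by placing a right comb of n carets after each of
    these points. The comb can be built only while everything on the left of
    its point e is covered, or else some point flips two more times; but to
    cover e off the left spine, a point on its left must be exposed. Hence some
    point makes a loop from the left spine and back, which costs two more flips
    when the right task is done first (early_excursion, excursion_loop,
    early_loops_by). A tall left comb above each right comb makes it
    indestructible in L letters (mid_of_actw), and having many such blocks keeps
    z out of reach in L letters (far_actw). *)

(** * The action of F on the half-line *)
Section Action.
Variable R : archiRealFieldType.
Implicit Types (q r t : R) (i j k n : nat) (a : letter nat) (u v w : word nat).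

(** The element x_i as a homeomorphism of the line that fixes 0. It sees the
    half-line as the row of unit intervals [k, k + 1] and cuts the interval of
    index i into two unit intervals; merge_at is its inverse. In the picture of
    F by pairs of forests, the unit intervals are the trees of the second
    forest, and q is a gap between leaves: it is a natural number when it
    separates two trees, and otherwise it is the caret that covers the gap.
    Outside the half-line the formula only has to be a bijection. *)
Definition split_at i q : R :=
  if q <= i%:R then q else if q <= i%:R + 1 then 2 * q - i%:R else q + 1.

Definition merge_at i q : R :=
  if q <= i%:R then q else if q <= i%:R + 2 then (q + i%:R) / 2 else q - 1.

(** A right action, so that a word acts by its letters from left to right. *)
Definition act a q : R := if a.2 then merge_at a.1 q else split_at a.1 q.

Definition actw w q : R := foldl (fun q' a => act a q') q w.

Lemma split_atK i : cancel (split_at i) (merge_at i).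
Proof.
move=> q; rewrite /merge_at /split_at.
by do ! case: ifPn; rewrite -?ltNge => *; lra.
Qed.

Lemma merge_atK i : cancel (merge_at i) (split_at i).
Proof.
move=> q; rewrite /merge_at /split_at.
by do ! case: ifPn; rewrite -?ltNge => *; lra.
Qed.

Lemma actVK a : cancel (act a) (act (linv a)).
Proof. by case: a => i [] q; rewrite /act /= ?split_atK ?merge_atK. Qed.

Lemma actKV a : cancel (act (linv a)) (act a).
Proof. by move=> q; rewrite -{1}(linvK a) actVK. Qed.

Lemma act_lt a q r : (act a q < act a r) = (q < r).
Proof.
have mono b x y : x < y -> act b x < act b y.
  case: b => i []; rewrite /act /= /merge_at /split_at => xy;
  by do ! case: ifPn; rewrite -?ltNge => *; lra.
apply/idP/idP; last exact: mono.
by move/(mono (linv a)); rewrite !actVK.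
Qed.

Lemma actw_cat u v q : actw (u ++ v) q = actw v (actw u q).
Proof. exact: foldl_cat. Qed.

Lemma actw_rel i j q : (i < j)%N ->
  actw [:: (i, true); (j, false); (i, false)] q = actw [:: (j.+1, false)] q.
Proof.
move=> ij; rewrite /actw /= /act /=.
rewrite -{2}(merge_atK i q); move: (merge_at i q) => x.
have {}ij : i%:R + 1 <= j%:R :> R by rewrite natr1 ler_nat.
rewrite /split_at -!natr1.
by do ! case: ifPn; rewrite -?ltNge => *; lra.
Qed.

Lemma actw_pres u v : pres_eq thompson_rel u v -> actw u =1 actw v.
Proof.
elim=> {u v} //.
- by move=> u v _ IH q; rewrite IH.
- by move=> u v w _ IH _ IH' q; rewrite IH IH'.
- by move=> u u' v v' _ IH _ IH' q; rewrite !actw_cat IH IH'.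
- by move=> a q; rewrite /actw /= actVK.
- by move=> u v [i j ij] q; apply: actw_rel.
Qed.

Lemma actw_lt w q r : (actw w q < actw w r) = (q < r).
Proof. by elim: w q r => //= a w IH q r; rewrite IH act_lt. Qed.

Lemma actw_inj w : injective (actw w).
Proof.
move=> q r qr; apply/eqP; case: (ltgtP q r) => //; rewrite -(actw_lt w) qr.
  by rewrite ltxx.
by rewrite ltxx.
Qed.

Lemma act0 a : act a 0 = 0.
Proof. by case: a => i []; rewrite /act /= /merge_at /split_at ler0n. Qed.

Lemma actw0 w : actw w 0 = 0.
Proof. by elim: w => //= a w IH; rewrite /actw /= act0. Qed.

Lemma actw_gt0 w q : (0 < actw w q) = (0 < q).
Proof. by rewrite -{1}(actw0 w) actw_lt. Qed.

Lemma actw_surj w q : exists t, actw w t = q.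
Proof.
elim: w q => [|a w IH] q; first by exists q.
by have [t <-] := IH q; exists (act (linv a) t); rewrite /= /actw /= actKV.
Qed.

Local Notation isnat q := (q \is a Num.nat).

Lemma nat_between k q : k%:R < q -> q < k%:R + 1 -> isnat q = false.
Proof.
move=> kq qk; apply/negP => /natrP [m mq]; move: kq qk; rewrite mq.
by rewrite natr1 !ltr_nat; lia.
Qed.

Lemma isnat_addr1 q : 0 <= q -> isnat (q + 1) = isnat q.
Proof.
move=> q0; apply/natrP/natrP => [[m mq]|[m mq]].
  case: m mq => [|m]; first by move=> h; lra.
  by rewrite -natr1 => h; exists m; lra.
by exists m.+1; rewrite mq natr1.
Qed.

Lemma isnat_subr1 q : 1 <= q -> isnat (q - 1) = isnat q.
Proof. by move=> q1; rewrite -(@isnat_addr1 (q - 1)) ?subr_ge0 // subrK. Qed.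

(** The one point that the letter a moves into or out of the naturals. *)
Definition flip_pt a : R := if a.2 then a.1%:R + 1 else a.1%:R + 2^-1.

(** A letter uncovers or covers a single gap: merging two unit intervals
    covers the gap between them, and cutting one uncovers its midpoint. *)
Lemma flip_ptP a q : isnat (act a q) != isnat q -> q = flip_pt a.
Proof.
have flip_merge i r : isnat (merge_at i r) != isnat r -> r = i%:R + 1.
  apply: contraNeq => nr; rewrite /merge_at.
  have i0 : 0 <= i%:R :> R by rewrite ler0n.
  case: ifPn => //; rewrite -ltNge => ir; case: ifPn => [ri2|]; last first.
    by rewrite -ltNge => h; rewrite isnat_subr1 //; lra.
  have [ri'|ri'] := ltP r (i%:R + 2); last first.
    have -> : r = i%:R + 2 by lra.
    have -> : (i%:R + 2 + i%:R) / 2 = i.+1%:R :> R by rewrite -(natr1 i); lra.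
    have -> : i%:R + 2 = i.+2%:R :> R by rewrite -(natr1 i.+1) -(natr1 i); lra.
    by rewrite !natr_nat.
  rewrite (@nat_between i ((r + i%:R) / 2)); [|lra|lra].
  apply/eqP/esym.
  have [ri|ri] := ltP r (i%:R + 1); first exact: (@nat_between i).
  apply: (@nat_between i.+1); rewrite -(natr1 i); last lra.
  by rewrite lt_neqAle eq_sym nr.
case: a => i [] /=; rewrite /flip_pt /act /=; first exact: flip_merge.
move=> h; rewrite -(split_atK i q); rewrite eq_sym -{1}(split_atK i q) in h.
rewrite (flip_merge _ _ h) /merge_at.
by do ! case: ifPn; rewrite -?ltNge => *; lra.
Qed.

(** These are the carets whose subtree contains the leftmost leaf. They
    matter because the left end of the line can be reached only by uncovering
    them one after the other, with x_0. *)
Definition leftspine q : Prop := exists j, q = 2^-1 ^+ j.+1.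

(** The values are chosen for their distances: a point passes between
    the left spine (0) and the other covered positions (2) only through the
    naturals (1), so the number of times it flips is at least the variation of
    its status. *)
Definition status q : nat :=
  if isnat q then 1%N else if `[< leftspine q >] then 0%N else 2%N.

Lemma status_le2 q : (status q <= 2)%N.
Proof. by rewrite /status; do ! case: ifP. Qed.

Lemma status1 q : (status q == 1%N) = isnat q.
Proof. by rewrite /status; do ! case: ifP. Qed.

Lemma halfX_gt0 j : 0 < 2^-1 ^+ j :> R.
Proof. by rewrite exprn_gt0 // invr_gt0 ltr0n. Qed.

Lemma halfX_le1 j : 2^-1 ^+ j <= 1 :> R.
Proof. by rewrite exprn_ile1 // ?invr_ge0 ?ler0n // invf_le1 ?ler1n ?ltr0n. Qed.

Lemma halfX_S j : 2^-1 ^+ j.+1 = 2^-1 ^+ j / 2 :> R.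
Proof. by rewrite exprSr. Qed.

Lemma leftspine_nat q : leftspine q -> isnat q = false.
Proof.
case=> j ->; apply: (@nat_between 0); first exact: halfX_gt0.
by rewrite add0r halfX_S; have := halfX_le1 j; lra.
Qed.

Lemma status0 q : (status q == 0%N) = `[< leftspine q >].
Proof.
rewrite /status; case: ifP => // nq; last by case: ifP.
by apply/esym/asboolP => /leftspine_nat; rewrite nq.
Qed.

Lemma act_le1 i b q : q <= 1 -> (0 < i)%N -> act (i, b) q = q.
Proof.
move=> q1 i0; have i1 : 1 <= i%:R :> R by rewrite ler1n.
by case: b; rewrite /act /= /merge_at /split_at (le_trans q1 i1).
Qed.

Lemma act00 q : 0 < q -> q <= 1 -> act (0%N, false) q = 2 * q.
Proof. by move=> *; rewrite /act /= /split_at; do ! case: ifPn; lra. Qed.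

Lemma act01 q : 0 < q -> q <= 2 -> act (0%N, true) q = q / 2.
Proof. by move=> *; rewrite /act /= /merge_at; do ! case: ifPn; lra. Qed.

Lemma leftspine_act a q : leftspine q -> isnat (act a q) = false ->
  leftspine (act a q).
Proof.
case: a => [[|i] b] [j ->]; last by rewrite act_le1 ?halfX_le1 // => _; exists j.
case: b; last first.
  rewrite act00 ?halfX_gt0 ?halfX_le1 // halfX_S mulrCA divff ?mulr1; last first.
    by rewrite pnatr_eq0.
  by case: j => [|j]; [rewrite expr0 nat_num1 | exists j].
rewrite act01 ?halfX_gt0 //; last by have := halfX_le1 j.+1; lra.
by move=> _; exists j.+1; rewrite [RHS]halfX_S.
Qed.

Lemma status_act a q :
  (status (act a q) <= status q + (isnat q != isnat (act a q)) /\
   status q <= status (act a q) + (isnat q != isnat (act a q)))%N.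
Proof.
have lsE : isnat q = false -> isnat (act a q) = false ->
    `[< leftspine q >] = `[< leftspine (act a q) >].
  move=> nq nq'; apply/asboolP/asboolP => h; first exact: leftspine_act.
  by rewrite -(actVK a q); apply: leftspine_act; rewrite ?actVK.
rewrite /status; case nq: (isnat q); case nq': (isnat (act a q)) => //=;
  try by case: ifP.
by rewrite lsE //; case: ifP.
Qed.

End Action.

(** * Midpoints of dyadic intervals *)
Section Cap.
Variable R : archiRealFieldType.
Implicit Types (q l r t : R) (c i j k n v : nat) (a : letter nat).
Local Notation isnat q := (q \is a Num.nat).

(** In terms of carets, [l, l + 2^-v] is the interval of leaves below the
    caret q, which has v carets above it. *)
Definition mid_of v q l : Prop :=
  exists c, l = c%:R * 2^-1 ^+ v /\ q = l + 2^-1 ^+ v.+1.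

Lemma natX_half v : (2 ^ v)%:R * 2^-1 ^+ v = 1 :> R.
Proof. by rewrite natrX -exprMn divff ?expr1n // pnatr_eq0. Qed.

Lemma natM_half v k : (k * 2 ^ v)%:R * 2^-1 ^+ v = k%:R :> R.
Proof. by rewrite natrM -mulrA natX_half mulr1. Qed.

Lemma le_natX_half v c k : (c <= k * 2 ^ v)%N -> c%:R * 2^-1 ^+ v <= k%:R :> R.
Proof.
move=> ck; rewrite -(natM_half v).
by rewrite ler_pM2r ?halfX_gt0 // ler_nat.
Qed.

Lemma ge_natX_half v c k : (k * 2 ^ v <= c)%N -> k%:R <= c%:R * 2^-1 ^+ v :> R.
Proof.
move=> ck; rewrite -(natM_half v).
by rewrite ler_pM2r ?halfX_gt0 // ler_nat.
Qed.

Lemma mid_of_nonnat v q l : mid_of v q l -> isnat q = false.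
Proof.
case=> c [-> ->]; have y0 := @halfX_gt0 R v; rewrite halfX_S.
have N0 : (0 < 2 ^ v)%N by rewrite expn_gt0.
have := @ge_natX_half v c (c %/ 2 ^ v) (leq_divM _ _).
have := @le_natX_half v c.+1 (c %/ 2 ^ v).+1.
rewrite -(natr1 c) -(natr1 (c %/ _)) mulrDl mul1r ltn_ceil // => /(_ isT) h1 h2.
by apply: (@nat_between _ (c %/ 2 ^ v)); lra.
Qed.

(** Parity of the numerator: no dyadic interval of length less than 1 has
    its midpoint at a half-integer. *)
Lemma mid_of_half v i l : mid_of v (i%:R + 2^-1) l -> l = i%:R.
Proof.
case=> c [lE qE]; case: v lE qE => [|v] lE qE.
  by rewrite halfX_S expr0 in qE; lra.
rewrite lE !halfX_S in qE; have hM := natX_half v.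
have : ((2 * c + 1)%:R = (2 * 2 ^ v * (2 * i + 1))%:R :> R).
  have -> : (2 * c + 1)%:R = 2 * c%:R + 1 :> R by rewrite natrD natrM.
  have -> : (2 * 2 ^ v * (2 * i + 1))%:R = 2 * 2 ^+ v * (2 * i%:R + 1) :> R.
    by rewrite natrM natrM (natrD _ _ 1) natrM natrX.
  rewrite natrX in hM.
  move: (2 ^+ v) (2^-1 ^+ v) hM qE => M z hM qE.
  have -> : 2 * c%:R + 1 = 4 * M * (c%:R * (z / 2) + z / 2 / 2) :> R.
    by transitivity ((2 * c%:R + 1) * (M * z)); [rewrite hM mulr1 | field].
  by rewrite -qE; field.
by move/eqP; rewrite eqr_nat => /eqP /(congr1 odd); rewrite -mulnA oddD !oddM.
Qed.

(** As long as q stays covered, a letter acts affinely on the dyadic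
    interval around q, hence preserves its left end. *)
Lemma mid_of_act v q l a : mid_of v q l -> isnat (act a q) = false ->
  exists v', (v <= v'.+1)%N /\ mid_of v' (act a q) (act a l).
Proof.
case=> c [lE qE]; have y0 := @halfX_gt0 R v; have hN := natX_half v.
have N0 : (0 < 2 ^ v)%N by rewrite expn_gt0.
have [i b] := (a.1, a.2); case: a => {}i {}b.
have lt1 k : (c < k * 2 ^ v)%N -> l + 2^-1 ^+ v <= k%:R.
  by move=> h; have := @le_natX_half v c.+1 k h; rewrite -natr1 mulrDl mul1r lE.
have ge1 k : (k * 2 ^ v <= c)%N -> k%:R <= l.
  by move=> h; have := @ge_natX_half v c k h; rewrite lE.
rewrite halfX_S in qE.
have [ci|ci] := ltnP c (i * 2 ^ v).
  have h := lt1 _ ci.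
  have -> : act (i, b) q = q.
    by rewrite /act /= /merge_at /split_at; do 2! case: ifP; lra.
  have -> : act (i, b) l = l.
    by rewrite /act /= /merge_at /split_at; do 2! case: ifP; lra.
  by move=> _; exists v; split; [|exists c; rewrite lE halfX_S qE lE].
have hi := ge1 _ ci; case: b.
  have [ci2|ci2] := ltnP c (i.+2 * 2 ^ v).
    have := lt1 _ ci2; rewrite -(natr1 i.+1) -(natr1 i) => h.
    have -> : act (i, true) q = (q + i%:R) / 2.
      by rewrite /act /= /merge_at; do ! case: ifPn; rewrite -?ltNge; lra.
    have -> : act (i, true) l = (l + i%:R) / 2.
      by rewrite /act /= /merge_at; do ! case: ifPn; rewrite -?ltNge; lra.
    move=> _; exists v.+1; split; first lia.
    exists (c + i * 2 ^ v)%N; rewrite !halfX_S natrD natrM qE lE; split; last first.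
      by field.
    have := natM_half v i; rewrite natrM; move: (2 ^ v)%:R (2^-1 ^+ v) => N y hi'.
    by transitivity ((c%:R * y + i%:R * N * y) / 2); [rewrite hi' | field].
  have := ge1 _ ci2; rewrite -(natr1 i.+1) -(natr1 i) => h.
  have -> : act (i, true) q = q - 1.
    by rewrite /act /= /merge_at; do ! case: ifPn; rewrite -?ltNge; lra.
  have -> : act (i, true) l = l - 1.
    by rewrite /act /= /merge_at; do ! case: ifPn; rewrite -?ltNge; lra.
  move=> _; exists v; split; first lia.
  have Nc : (2 ^ v <= c)%N.
    by apply: leq_trans ci2; rewrite -{1}[(2 ^ v)%N]mul1n leq_mul2r orbT.
  exists (c - 2 ^ v)%N; rewrite natrB // mulrBl hN -lE qE halfX_S; split=> //.
  by ring.
have [ci2|ci2] := ltnP c (i.+1 * 2 ^ v).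
  have := lt1 _ ci2; rewrite -(natr1 i) => h.
  have -> : act (i, false) q = 2 * q - i%:R.
    by rewrite /act /= /split_at; do ! case: ifPn; rewrite -?ltNge; lra.
  have -> : act (i, false) l = 2 * l - i%:R.
    by rewrite /act /= /split_at; do ! case: ifPn; rewrite -?ltNge; lra.
  case: v lE qE hN ci ci2 {lt1 ge1 N0 y0} h => [|v] lE qE hN ci ci2 h.
    have ->: 2 * q - i%:R = i.+1%:R by rewrite -natr1 qE expr0 in h *; lra.
    by rewrite natr_nat.
  move=> _; exists v; split; first lia.
  have hM := natX_half v; rewrite halfX_S in lE qE.
  have ci' : (i * 2 ^ v <= c)%N.
    by apply: leq_trans ci; rewrite expnS leq_mul2l leq_pmull ?orbT.
  exists (c - i * 2 ^ v)%N; rewrite natrB // natrM mulrBl -mulrA hM.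
  by rewrite qE lE halfX_S; split; field.
have := ge1 _ ci2; rewrite -(natr1 i) => h.
have -> : act (i, false) q = q + 1.
  by rewrite /act /= /split_at; do ! case: ifPn; rewrite -?ltNge; lra.
have -> : act (i, false) l = l + 1.
  by rewrite /act /= /split_at; do ! case: ifPn; rewrite -?ltNge; lra.
move=> _; exists v; split; first lia.
exists (c + 2 ^ v)%N; rewrite natrD mulrDl hN -lE qE halfX_S; split=> //.
by ring.
Qed.

(** A caret that has another one above it cannot be uncovered by one
    letter, and loses at most one of the carets above it. *)
Lemma mid_of_act_deep v q l a : mid_of v.+1 q l ->
  exists v', (v <= v')%N /\ mid_of v' (act a q) (act a l).
Proof.
move=> h; have nq := mid_of_nonnat h.
have nq' : isnat (act a q) = false.
  apply/negP => nq'; have := @flip_ptP _ a q; rewrite nq nq' => /(_ isT).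
  rewrite /flip_pt; case: ifP => _ qE.
    by move: nq; rewrite qE natr1 natr_nat.
  move: h; rewrite qE => h; have lE := mid_of_half h; case: h => c [_].
  rewrite lE !halfX_S => h.
  by have := halfX_le1 R v; lra.
by have [v' [vv' h']] := mid_of_act h nq'; exists v'.
Qed.

End Cap.

(** * Words as motions of points *)
Lemma last_change (b : nat -> bool) k0 N : (k0 <= N)%N -> b k0 -> ~~ b N ->
  exists k, [/\ (k0 <= k < N)%N, b k &
                forall k', (k < k' <= N)%N -> ~~ b k'].
Proof.
elim: N => [|N IH] k0N bk0 bN.
  move: bk0 bN; have -> : k0 = 0%N by lia.
  by move=> ->.
have [k0N'|k0N'] := leqP k0 N; last first.
  move: bk0 bN; have -> : k0 = N.+1 by lia.
  by move=> ->.
case bN': (b N).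
  exists N; split=> // [|k' h]; first lia.
  by have -> : k' = N.+1 by lia.
have [k [h1 h2 h3]] := IH k0N' bk0 (negbT bN').
exists k; split=> // [|k' h]; first lia.
have [h4|h4] := leqP k' N; first by apply: h3; lia.
by have -> : k' = N.+1 by lia.
Qed.

Section Path.
Variable R : archiRealFieldType.
Implicit Types (q r t : R) (i j k u v : nat) (a : letter nat).
Local Notation isnat q := (q \is a Num.nat).

Variable w : word nat.
Definition pos_at t k := actw (take k w) t.
Definition exposed_at t k := isnat (pos_at t k).
Definition state_at t k := status (pos_at t k).
Definition flips_in t u v :=
  (\sum_(u <= k < v) (exposed_at t k != exposed_at t k.+1))%N.

(** The first alternative covers the times after the end of w, where the
    motion stops; stating both cases frees the later lemmas of bounds. *)
Lemma pos_step k : (forall t, pos_at t k.+1 = pos_at t k) \/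
  exists2 a, a \in w & forall t, pos_at t k.+1 = act a (pos_at t k).
Proof.
have [kw|kw] := ltnP k (size w); last first.
  by left=> t; rewrite /pos_at !take_oversize // (leq_trans kw).
right; exists (nth (0%N, true) w k); first exact: mem_nth.
by move=> t; rewrite /pos_at (take_nth (0%N, true)) // -cats1 actw_cat.
Qed.

Lemma pos_lt t r k : (pos_at t k < pos_at r k) = (t < r).
Proof. exact: actw_lt. Qed.

Lemma pos_inj k : injective (pos_at^~ k).
Proof. exact: actw_inj. Qed.

Lemma pos_gt0 t k : (0 < pos_at t k) = (0 < t).
Proof. exact: actw_gt0. Qed.

Lemma pos_0 t : pos_at t 0 = t.
Proof. by rewrite /pos_at take0. Qed.

Lemma pos_size t : pos_at t (size w) = actw w t.
Proof. by rewrite /pos_at take_size. Qed.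

Lemma state0 t : state_at t 0 = status t.
Proof. by rewrite /state_at pos_0. Qed.

Lemma exposed0 t : exposed_at t 0 = isnat t.
Proof. by rewrite /exposed_at pos_0. Qed.

Lemma state_exposed t k : (state_at t k == 1%N) = exposed_at t k.
Proof. exact: status1. Qed.

Lemma state_le2 t k : (state_at t k <= 2)%N.
Proof. exact: status_le2. Qed.

Lemma flips_cat t u m v : (u <= m)%N -> (m <= v)%N ->
  flips_in t u v = (flips_in t u m + flips_in t m v)%N.
Proof. by move=> um mv; rewrite /flips_in (big_cat_nat um mv). Qed.

Lemma flips_state t u v : (u <= v)%N ->
  (state_at t u <= state_at t v + flips_in t u v /\
   state_at t v <= state_at t u + flips_in t u v)%N.
Proof.
elim: v => [|v IH] uv.
  have -> : u = 0%N by lia.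
  by rewrite !leq_addr.
have [uv'|uv'] := leqP u v; last first.
  have -> : u = v.+1 by lia.
  by rewrite !leq_addr.
have [h1 h2] := IH uv'.
rewrite (@flips_cat _ u v) // {2 4}/flips_in big_nat1.
have : (state_at t v.+1 <= state_at t v + (exposed_at t v != exposed_at t v.+1) /\
        state_at t v <= state_at t v.+1 + (exposed_at t v != exposed_at t v.+1))%N.
  rewrite /state_at /exposed_at; case: (pos_step v) => [->|[a _ ->]].
    by rewrite !leq_addr.
  exact: status_act.
by lia.
Qed.

(** Each letter flips at most one point. This is the only source of lower
    bounds on word length: to bound a length, bound the flips of many points. *)
Lemma flips_count (Q : seq R) : uniq Q ->
  (\sum_(t <- Q) flips_in t 0 (size w) <= size w)%N.
Proof.
move=> uQ; rewrite /flips_in exchange_big /=.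
apply: (@leq_trans (\sum_(0 <= k < size w) 1)); last first.
  by rewrite sum_nat_const_nat muln1 subn0.
apply: leq_sum => k _.
have [c hc] : exists c, forall t, (exposed_at t k != exposed_at t k.+1) -> t = c.
  case: (pos_step k) => [h|[a _ h]].
    by exists 0 => t; rewrite /exposed_at h eqxx.
  have [c hc] := actw_surj (take k w) (flip_pt R a).
  exists c => t; rewrite /exposed_at h eq_sym => /flip_ptP hf.
  by apply: (@actw_inj _ (take k w)); rewrite hc -hf.
elim: Q uQ => [|t Q IH] /=; first by rewrite big_nil.
case/andP=> tQ uQ; rewrite big_cons.
case ft: (exposed_at t k != exposed_at t k.+1); last by rewrite add0n IH.
rewrite big_seq big1 ?addn0 // => r rQ.
case fr: (exposed_at r k != exposed_at r k.+1) => //.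
by move: tQ; rewrite (hc _ ft) -(hc _ fr) rQ.
Qed.

Lemma cover_step t k : exposed_at t k -> ~~ exposed_at t k.+1 ->
  exists i, [/\ (i, true) \in w, pos_at t k = i%:R + 1 &
                forall r, pos_at r k.+1 = act (i, true) (pos_at r k)].
Proof.
rewrite /exposed_at; case: (pos_step k) => [-> ->//|[a aw h]] tk ntk.
have := @flip_ptP _ a (pos_at t k); rewrite -h tk (negbTE ntk) => /(_ isT).
case: a aw h => i [] aw h; rewrite /flip_pt /= => tE; first by exists i.
move: tk; rewrite tE (@nat_between _ i) //; first by rewrite ltrDl invr_gt0.
by rewrite ltrD2l invf_lt1 // ltr1n.
Qed.

(** Letters are reversible, so the history of a caret can be read off
    backwards from its final position until the caret was created. *)
Lemma mid_of_back t r N u v : (u <= N)%N ->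
  (forall k, (u <= k <= N)%N -> ~~ exposed_at t k) ->
  mid_of v (pos_at t N) (pos_at r N) -> exists v', mid_of v' (pos_at t u) (pos_at r u).
Proof.
elim: N v => [|N IH] v uN h hc.
  by exists v; have -> : u = 0%N by lia.
have [uN'|uN'] := leqP u N; last first.
  by exists v; have -> : u = N.+1 by lia.
have hN : ~~ exposed_at t N by apply: h; lia.
have h' k : (u <= k <= N)%N -> ~~ exposed_at t k by move=> hk; apply: h; lia.
case: (pos_step N) => [e|[a _ e]].
  by apply: (IH v) => //; rewrite -!e.
have eV x : pos_at x N = act (linv a) (pos_at x N.+1) by rewrite e actVK.
have [v' [_ hv']] : exists v', (v <= v'.+1)%N /\ mid_of v' (pos_at t N) (pos_at r N).
  by rewrite !eV; apply: mid_of_act => //; rewrite -eV; apply: negbTE.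
exact: (IH v').
Qed.

(** The caret t was last created by merging two unit intervals, and the
    left one began at what is still the left end of the interval of t. So the
    final position of t tells which point was exposed when t was covered for
    the last time. *)
Lemma last_cover t r N k v : (k < N)%N -> exposed_at t k ->
  (forall k', (k < k' <= N)%N -> ~~ exposed_at t k') ->
  mid_of v (pos_at t N) (pos_at r N) ->
  exists i, [/\ (i, true) \in w, pos_at t k = i%:R + 1 & pos_at r k = i%:R].
Proof.
move=> kN tk h hc.
have [|i [iw tE e]] := cover_step tk; first by apply: h; lia.
exists i; split=> //.
have [v' hv'] := mid_of_back kN h hc.
have := hv'; rewrite e tE.
have -> : act (i, true) (i%:R + 1) = i%:R + 2^-1 :> R.
  by rewrite /act /= /merge_at; do ! case: ifPn; rewrite -?ltNge; lra.
move/mid_of_half; rewrite e => rE.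
rewrite -(actVK (i, true) (pos_at r k)) rE.
by rewrite /act /= /split_at lexx.
Qed.

End Path.

(** Near 0 every word acts by multiplication by a power of 2. Choose M so
    that 2^-M is carried to 1 when this power is the greatest; then 2^-M never
    leaves ]0, 1], so it goes from the left spine to a natural and back. *)
Lemma germ_peak (R : archiRealFieldType) (w : word nat) :
  exists M (j : nat -> nat),
    (forall c k, actw (take k w) (2^-1 ^+ (M + c) : R) = 2^-1 ^+ (j k + c)) /\
    exists2 k, (k <= size w)%N & j k = 0%N.
Proof.
elim: w => [|a w [M [j [hj [k kw jk]]]]].
  by exists 0%N, (fun=> 0%N); split=> //; exists 0%N.
have up M' : (forall c, act a (2^-1 ^+ (M' + c)) = 2^-1 ^+ (M + c) :> R) ->
  exists M (j : nat -> nat),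
    (forall c k, actw (take k (a :: w)) (2^-1 ^+ (M + c) : R) =
                 2^-1 ^+ (j k + c)) /\
    exists2 k, (k <= size (a :: w))%N & j k = 0%N.
  move=> h; exists M', (fun k => if k is k'.+1 then j k' else M'); split.
    by move=> c [|k'] //=; rewrite /actw /= h; apply: hj.
  by exists k.+1.
have h01 c m : act (0%N, true) (2^-1 ^+ (m + c)) = 2^-1 ^+ (m.+1 + c) :> R.
  rewrite act01 ?halfX_gt0 ?addSn ?halfX_S //.
  by have := @halfX_le1 R (m + c); lra.
case: a up => [[|i] b] up; last first.
  by apply: (up M) => c; rewrite act_le1 // halfX_le1.
case: b up => up; last first.
  apply: (up M.+1) => c; rewrite act00 ?halfX_gt0 ?halfX_le1 // addSn halfX_S.
  by field.
case: M hj up => [|M] hj up; last by apply: (up M).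
exists 0%N, (fun k => if k is k'.+1 then (j k').+1 else 0%N); split.
  move=> c [|k'] //=; rewrite /actw /= -/(act _ _) h01.
  by have := hj c.+1 k'; rewrite /actw addnS => ->; rewrite addnS.
by exists 0%N.
Qed.

(** * Marked points, and words that go left first *)
(** The least number of flips of a point with initial status s0 and final
    status h, if it must be covered at some time T and must be off the left
    spine at some later time T'. In left_first_cost the two times come in the
    opposite order. *)
Definition right_first_cost s0 h : nat :=
  if s0 == 0%N then (if h == 1%N then 1 else 2)%N
  else if h == 0%N then 3%N else if h == 1%N then 2%N else 1%N.
Definition left_first_cost s0 h : nat :=
  if s0 == 0%N then (if h == 1%N then 3 else 2)%N
  else if h == 1%N then 2%N else 1%N.

Section Points.
Variable R : archiRealFieldType.
Variables n S B D : nat.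
(** The marked points. The left points 2^-1, .., 2^-D start on the left
    spine. The naturals to the right of 0 start exposed: they form B blocks of
    S points, then n more points, and a last point zpt which has to be covered
    in the end. Because n exposed points separate the blocks from zpt, all the
    points of the blocks can be covered when zpt is. *)
Definition lpt j : R := 2^-1 ^+ j.+1.
Definition bpt i j : R := (i * S + j).+1%:R.
Definition zpt : R := (B * S + n).+1%:R.
Definition lpts := [seq lpt j | j <- iota 0 D].
Definition bpts := [seq bpt i j | i <- iota 0 B, j <- iota 0 S].
Definition fpts := [seq bpt B j | j <- iota 0 n].
Definition pts := lpts ++ bpts ++ fpts.

Lemma lpt_lt1 j : lpt j < 1.
Proof. by rewrite /lpt halfX_S; have := halfX_le1 R j; lra. Qed.

Lemma bpt_ge1 i j : 1 <= bpt i j.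
Proof. by rewrite ler1n. Qed.

Lemma lpt_le i j : (i <= j)%N -> lpt j <= lpt i.
Proof.
move=> ij; rewrite /lpt ler_wiXn2l ?invr_ge0 ?ler0n //.
by rewrite invf_le1 ?ler1n ?ltr0n.
Qed.

Lemma lpt_inj : injective lpt.
Proof.
have lt i j : (i < j)%N -> lpt j < lpt i.
  move=> ij; apply: le_lt_trans (lpt_le ij) _.
  by rewrite /lpt [ltLHS]halfX_S; have := halfX_gt0 R i.+1; lra.
move=> i j ij; case: (ltngtP i j) => // /lt; rewrite ij ltxx //.
Qed.

Lemma bpt_inj i j i' j' : bpt i j = bpt i' j' -> (j < S)%N -> (j' < S)%N ->
  (i = i' /\ j = j')%N.
Proof.
move/eqP; rewrite eqr_nat eqSS => /eqP e jS j'S.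
have ii' : i = i'.
  have := congr1 (fun x => x %/ S)%N e.
  by rewrite !divnMDl ?divn_small ?addn0 //; lia.
by split=> //; move: e; rewrite ii'; lia.
Qed.

Lemma zpts_uniq : uniq (zpt :: pts).
Proof.
rewrite /= !mem_cat !negb_or -!andbA; apply/and4P; split.
- by apply/mapP => -[j _ h]; have := lpt_lt1 j; rewrite -h /zpt ltrn1.
- apply/allpairsP => -[[i j] [/=]]; rewrite !mem_iota => iB jS /eqP.
  rewrite eqr_nat eqSS => /eqP e.
  have : (i * S + j < i.+1 * S)%N by lia.
  have : (i.+1 * S <= B * S)%N by rewrite leq_mul2r; apply/orP; right; lia.
  by lia.
- apply/mapP => -[j]; rewrite mem_iota => jn /eqP.
  by rewrite eqr_nat; lia.
rewrite cat_uniq cat_uniq map_inj_uniq ?iota_uniq /=; last exact: lpt_inj.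
rewrite allpairs_uniq ?iota_uniq //=; last first.
  move=> [i j] [i' j'] /allpairsP[[a b] /= [_ h [-> ->]]]
    /allpairsP[[a' b'] /= [_ h' [-> ->]]].
  rewrite !mem_iota in h h' => e.
  by have [||-> ->] := bpt_inj e; [lia|lia|].
rewrite map_inj_uniq ?iota_uniq ?andbT; last first.
  by move=> j j' /eqP; rewrite eqr_nat; lia.
apply/andP; split.
  apply/hasPn => x; rewrite mem_cat => hx.
  have x1 : 1 <= x.
    by case/orP: hx => [/allpairsP[[i j] [_ _ ->]]|/mapP[j _ ->]]; apply: bpt_ge1.
  by apply/mapP => -[j _ h]; have := lpt_lt1 j; lra.
apply/hasPn => x /mapP[j jn ->]; apply/allpairsP => -[[i j'] [/=]].
rewrite !mem_iota => iB jS /eqP; rewrite eqr_nat eqSS => /eqP e.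
have : (i * S + j' < i.+1 * S)%N by lia.
have : (i.+1 * S <= B * S)%N by rewrite leq_mul2r; apply/orP; right; lia.
by lia.
Qed.

Lemma pts_bounds t : t \in pts -> 0 < t /\ t < zpt.
Proof.
have z1 : 1 <= zpt by rewrite ler1n.
rewrite !mem_cat => /or3P[/mapP[j _ ->]|/allpairsP[[i j] /= []]|/mapP[j]].
- by split; [exact: halfX_gt0 | have := lpt_lt1 j; lra].
- rewrite !mem_iota => iB jS ->; split; first by have := bpt_ge1 i j; lra.
  have : (i * S + j < i.+1 * S)%N by lia.
  have : (i.+1 * S <= B * S)%N by rewrite leq_mul2r; apply/orP; right; lia.
  by rewrite ltr_nat; lia.
- rewrite mem_iota => jn ->; split; first by have := bpt_ge1 B j; lra.
  by rewrite ltr_nat; lia.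
Qed.

Lemma pts_ge t : (0 < D)%N -> t \in pts -> lpt D.-1 <= t.
Proof.
move=> D0; rewrite mem_cat => /orP[/mapP[j]|ht].
  by rewrite mem_iota => jD ->; apply: lpt_le; lia.
apply: ltW; apply: lt_le_trans (lpt_lt1 _) _.
by move: ht; rewrite mem_cat
  => /orP[/allpairsP[[i j] [_ _ ->]]|/mapP[j _ ->]]; apply: bpt_ge1.
Qed.

Lemma status_lpt j : status (lpt j) = 0%N.
Proof. by apply/eqP; rewrite status0; apply/asboolP; exists j. Qed.

Lemma status_bpt i j : status (bpt i j) = 1%N.
Proof. by apply/eqP; rewrite status1 natr_nat. Qed.

Lemma status_pts t : t \in pts -> (status t <= 1)%N.
Proof.
rewrite !mem_cat => /or3P[/mapP[j _ ->]|/allpairsP[[i j] [_ _ ->]]|/mapP[j _ ->]];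
by rewrite ?status_lpt ?status_bpt.
Qed.

Section LeftFirst.
Variable w : word nat.
Local Notation N := (size w).
Local Notation pos := (@pos_at R w).
Local Notation exposed := (@exposed_at R w).
Local Notation state := (@state_at R w).
Local Notation flips := (@flips_in R w).

Lemma nat_lt1 (q r : R) : q \is a Num.nat -> r \is a Num.nat -> q < r -> q + 1 <= r.
Proof. by move=> /natrP[a ->] /natrP[b ->]; rewrite ltr_nat natr1 ler_nat. Qed.

Lemma state_ge1 t k : 1 <= pos t k -> (0 < state t k)%N.
Proof.
move=> h; rewrite lt0n status0; apply/asboolP => -[j e].
by have := lpt_lt1 j; rewrite /lpt -e; lra.
Qed.

(** The exposed points between 0 and z have distinct natural positions. *)
Lemma exposed_count (Q : seq R) z T P : uniq Q ->
  (forall t, t \in Q -> 0 < t /\ t < z) -> pos z T <= P.+1%:R ->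
  (\sum_(t <- Q) exposed t T <= P)%N.
Proof.
move=> uQ hQ hz.
have -> : (\sum_(t <- Q) exposed t T = size [seq t <- Q | exposed t T])%N.
  rewrite size_filter -sum1_count [RHS]big_mkcond; apply: eq_bigr => t _.
  by case: (exposed t T).
have -> : P = size (iota 1 P) by rewrite size_iota.
rewrite -(size_map (fun t => Num.trunc (pos t T))).
apply: uniq_leq_size.
  rewrite map_inj_in_uniq ?filter_uniq // => t r.
  rewrite !mem_filter => /andP[/natrP[a ta] _] /andP[/natrP[b rb] _].
  by rewrite ta rb !natrK => ab; apply: (@pos_inj _ w T); rewrite ta rb ab.
move=> _ /mapP[t + ->]; rewrite mem_filter => /andP[/natrP[a ta] tQ].
have [t0 tz] := hQ _ tQ; rewrite ta natrK mem_iota.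
move: t0; rewrite -(pos_gt0 w _ T) ta ltr0n => a0.
move: tz; rewrite -(pos_lt w _ _ T) ta => az.
by have := lt_le_trans az hz; rewrite ltr_nat; lia.
Qed.

Lemma flips_z : ~~ exposed zpt N -> (0 < flips zpt 0 N)%N.
Proof.
move=> h; have [] := @flips_state _ w zpt 0 N isT.
have : state zpt 0 = 1%N by apply/eqP; rewrite state_exposed exposed0 natr_nat.
by move: h; rewrite -state_exposed => /eqP; lia.
Qed.

(** When zpt is about to be covered, at time T, it is at position at most
    n + 1, so at most n marked points are exposed at time T. Each of these saves
    at most two flips with respect to the cost, which is the term 2 * n. *)
Lemma left_first_bound T T' : (0 < D)%N -> (T' <= T <= N)%N ->
  pos zpt T <= n.+1%:R -> 1 <= pos (lpt D.-1) T' -> ~~ exposed zpt N ->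
  (\sum_(t <- pts) left_first_cost (status t) (state t N) + 1 <= N + 2 * n)%N.
Proof.
move=> D0 TT zT lT zN; have /= /andP[zp uQ] := zpts_uniq.
have := flips_count w (zpts_uniq); rewrite big_cons.
have := @exposed_count pts zpt T n uQ pts_bounds zT.
have := flips_z zN.
suff : (\sum_(t <- pts) left_first_cost (status t) (state t N) <=
        \sum_(t <- pts) (flips t 0 N + 2 * exposed t T))%N.
  by rewrite big_split /= -big_distrr /=; lia.
rewrite big_seq [leqRHS]big_seq; apply: leq_sum => t tp.
have s0 := status_pts tp.
have s' : (0 < state t T')%N.
  apply: state_ge1; apply: le_trans lT _.
  by rewrite leNgt (pos_lt w) -leNgt pts_ge.
have E0 := state0 w t.
rewrite (@flips_cat _ w t 0 T N) ?(@flips_cat _ w t 0 T' T); try lia.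
have [a1 a2] := @flips_state _ w t 0 T' isT.
have [|b1 b2] := @flips_state _ w t T' T; first lia.
have [|c1 c2] := @flips_state _ w t T N; first lia.
have h2 := state_le2 w t N; have h3 := state_le2 w t T.
rewrite -state_exposed; rewrite E0 in a1 a2; rewrite /left_first_cost.
by do ! case: eqP; lia.
Qed.

End LeftFirst.
End Points.

(** * Words that go right first *)
(** The bookkeeping of one point. Its status is s0, sT, s1, h at times 0, T,
    T' and at the end, and it flips f1, f2, f3 times in between; l counts loops
    out of the left spine before T, m is 1 for a last such loop still open at
    time T, and x is 1 for a point that pays two flips more than its cost or is
    exposed at T without profit. *)
Lemma right_first_cost_le s0 sT s1 h f1 f2 f3 l m x :
  (s0 <= 1)%N -> (sT <= 2)%N -> (0 < s1)%N -> (h <= 2)%N ->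
  [/\ s0 + 2 * l <= sT + f1, sT + 2 * l <= s0 + f1,
      0 < l -> s0 + sT + 2 * l <= f1, m <= 1 &
      0 < m -> sT = 1%N /\ s0 + 1 + 2 * l <= f1]%N ->
  (sT <= s1 + f2 /\ s1 <= sT + f2)%N -> (s1 <= h + f3 /\ h <= s1 + f3)%N ->
  (x <= 1)%N -> (0 < x -> [/\ s0 = 1, h = 2 & sT = 1 \/ 2 < f1 + f2 + f3])%N ->
  (right_first_cost s0 h + 2 * x + 2 * (l + m) <= f1 + f2 + f3 + 2 * (sT == 1))%N.
Proof.
move=> a b c d [e1 e2 e3 e4 e5] g1 g2 x1 hx.
have [x0|x0] := posnP x.
  move: {hx x1} x0 => ->; case: s0 a e1 e2 e3 e5 => [|[|//]] _ e1 e2 e3 e5;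
  case: h d g2 => [|[|[|//]]] _ g2; rewrite /right_first_cost /=; lia.
have [x2 h2 hx2] := hx x0; rewrite {}x2 {}h2 /right_first_cost /= in e1 e2 e3 e5 g2 *.
have {hx x0 x1} -> : x = 1%N by lia.
lia.
Qed.

Section RightFirst.
Variable R : archiRealFieldType.
Variables n S B D : nat.
Variable w : word nat.
Variables T T' : nat.
Local Notation N := (size w).
Local Notation pos := (@pos_at R w).
Local Notation exposed := (@exposed_at R w).
Local Notation state := (@state_at R w).
Local Notation flips := (@flips_in R w).
Local Notation zp := (zpt R n S B).
Local Notation bp := (@bpt R S).
Local Notation ps := (pts R n S B D).

Hypothesis n_gt0 : (0 < n)%N.
Hypothesis nS : (n < S)%N.
Hypothesis D0 : (0 < D)%N.
Hypothesis w_n : forall i b, (i, b) \in w -> (i <= n)%N.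
Hypothesis TT' : (T <= T' <= N)%N.
Hypothesis zT : pos zp T <= n.+1%:R.
Hypothesis lT' : 1 <= pos (lpt R D.-1) T'.
Hypothesis zN : ~~ exposed zp N.
Hypothesis caps : forall i j, (i < B)%N -> (j < n)%N ->
  exists v, mid_of v (pos (bp i j.+1) N) (pos (bp i j) N).

(** The points of Q have made, by time u, at least c loops out of the left
    spine and back, on top of the flips forced by their status at time u. The
    function l distributes the loops over the points; Q has to grow with c as
    the points that loop need not be marked ones. *)
Definition loops_by u c : Prop := exists (Q : seq R) (l : R -> nat),
  [/\ uniq Q, {subset ps <= Q}, (forall t, t \in Q -> 0 < t /\ t < zp),
      (c <= \sum_(t <- Q) l t)%N &
      forall t, [/\ state t 0 + 2 * l t <= state t u + flips t 0 u,
                 state t u + 2 * l t <= state t 0 + flips t 0 u &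
                 0 < l t -> state t 0 + state t u + 2 * l t <= flips t 0 u]%N].

(** The same at time T, except that one of the loops may still be open, at a
    point where m is 1: this point is exposed at time T but has not saved the
    two flips that exposed points may save. *)
Definition loops_before_T c : Prop := exists (Q : seq R) (l m : R -> nat),
  [/\ uniq Q, {subset ps <= Q}, (forall t, t \in Q -> 0 < t /\ t < zp),
      (c <= \sum_(t <- Q) (l t + m t))%N &
      forall t, [/\ state t 0 + 2 * l t <= state t T + flips t 0 T,
                 state t T + 2 * l t <= state t 0 + flips t 0 T,
                 0 < l t -> state t 0 + state t T + 2 * l t <= flips t 0 T,
                 m t <= 1 &
                 0 < m t -> state t T = 1%N /\
                            state t 0 + 1 + 2 * l t <= flips t 0 T]%N].

Lemma loops_by0 : loops_by 0 0.
Proof.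
have /= /andP[_ uQ] := zpts_uniq R n S B D.
exists ps, (fun=> 0%N); split=> //; first exact: pts_bounds.
by move=> t; split=> //; rewrite muln0 addn0 leq_addr.
Qed.

Lemma loops_by_later u v c : (u <= v)%N -> loops_by u c -> loops_by v c.
Proof.
move=> uv [Q [l [uQ sQ hQ hc h]]]; exists Q, l; split=> // t.
have [h1 h2 h3] := h t; rewrite (@flips_cat _ w t 0 u v) //.
have [h4 h5] := @flips_state _ w t u v uv.
by split; [lia|lia|move=> /h3; lia].
Qed.

Lemma sum_bump (Q : seq R) (l : R -> nat) x : uniq Q ->
  exists Q', [/\ uniq Q', {subset Q <= Q'}, (forall t, t \in Q' -> t = x \/ t \in Q) &
    (\sum_(t <- Q) l t + 1 <= \sum_(t <- Q') (l t + (t == x)))%N].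
Proof.
move=> uQ; have [xQ|xQ] := boolP (x \in Q).
  exists Q; split=> //; first by right.
  rewrite big_split /= leq_add2l (big_rem x) //= eqxx; lia.
exists (x :: Q); split=> //=; first by rewrite xQ.
- by move=> t tQ; rewrite inE tQ orbT.
- by move=> t; rewrite inE => /orP[/eqP ->|->]; [left|right].
rewrite big_cons eqxx big_split /=; lia.
Qed.

Lemma loop_flips x u s v : (u <= s <= v)%N -> state x u = 0%N ->
  state x s = 1%N -> (1 + (1 - state x v) <= flips x u v)%N.
Proof.
move=> /andP[us sv] xu xs; rewrite (@flips_cat _ w x u s v) //.
have [_ h1] := @flips_state _ w x u s us.
have [h2 _] := @flips_state _ w x s v sv.
by lia.
Qed.

Lemma loops_by_add u s v c x : (u <= s <= v)%N -> 0 < x -> x < zp ->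
  state x u = 0%N -> state x s = 1%N -> state x v = 0%N ->
  loops_by u c -> loops_by v c.+1.
Proof.
move=> usv x0 xz xu xs xv [Q [l [uQ sQ hQ hc h]]].
have [Q' [uQ' QQ' hQ' hl]] := sum_bump l x uQ.
exists Q', (fun t => l t + (t == x))%N; split=> //.
- by move=> t /sQ /QQ'.
- by move=> t /hQ'[->|/hQ].
- by apply: leq_trans hl; rewrite addn1.
move=> t; have [h1 h2 h3] := h t; rewrite (@flips_cat _ w t 0 u v) //; last lia.
have [|h4 h5] := @flips_state _ w t u v; first lia.
have hl' := loop_flips usv xu xs; rewrite xv in hl'.
case: eqP => [E|_]; last by rewrite addn0; split; [lia|lia|move=> /h3; lia].
by rewrite E in h1 h2 h3 *; split; lia.
Qed.

Lemma loops_before_T_open u s c x : (u <= s <= T)%N -> 0 < x -> x < zp ->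
  state x u = 0%N -> state x s = 1%N -> state x T = 1%N ->
  loops_by u c -> loops_before_T c.+1.
Proof.
move=> usv x0 xz xu xs xT [Q [l [uQ sQ hQ hc h]]].
have [Q' [uQ' QQ' hQ' hl]] := sum_bump l x uQ.
exists Q', l, (fun t => (t == x) : nat); split=> //.
- by move=> t /sQ /QQ'.
- by move=> t /hQ'[->|/hQ].
- by apply: leq_trans hl; rewrite addn1.
move=> t; have [h1 h2 h3] := h t; rewrite (@flips_cat _ w t 0 u T) //; last lia.
have [|h4 h5] := @flips_state _ w t u T; first lia.
have hl' := loop_flips usv xu xs; rewrite xT in hl'.
case: eqP => [E|_]; last by split; [lia|lia|move=> /h3; lia|lia|lia].
by rewrite E in h1 h2 h3 h4 h5 *; split; lia.
Qed.

Lemma loops_before_TW c : loops_by T c -> loops_before_T c.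
Proof.
move=> [Q [l [uQ sQ hQ hc h]]]; exists Q, l, (fun=> 0%N); split=> //.
  by rewrite big_split /=; lia.
by move=> t; have [h1 h2 h3] := h t; split.
Qed.

(** The dangerous final positions: a block that is covered by carets off
    the left spine is cheaper by two, in both costs together, than a block with
    an exposed point or a point on the left spine. Such a block must be shown
    to cost two flips elsewhere. *)
Definition all_inner (i : nat) := all (fun j => state (bp i j) N == 2%N) (iota 0 S).
(** Such a point compensates for its block by itself. *)
Definition has_slack (t : R) :=
  (state t N == 2%N) && (exposed t T || (3 <= flips t 0 N)%N).
(** In an early block no point has slack, so each point of the block is
    covered once and for all before T, and the compensation must come from
    other points. *)
Definition early i := all_inner i && ~~ has (fun j => has_slack (bp i j)) (iota 0 S).

Lemma earlyP i j : early i -> (j < S)%N ->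
  [/\ state (bp i j) N = 2%N, exposed (bp i j) T = false & (flips (bp i j) 0 N < 3)%N].
Proof.
case/andP => /allP aI /hasPn h jS.
have ji : j \in iota 0 S by rewrite mem_iota.
have := h _ ji; rewrite /has_slack; have /eqP -> := aI _ ji.
by rewrite eqxx /= negb_or -ltnNge => /andP[/negbTE -> ->].
Qed.

Lemma stays_covered i j k1 k2 : early i -> (j < S)%N -> (k1 <= k2 <= N)%N ->
  ~~ exposed (bp i j) k1 -> ~~ exposed (bp i j) k2.
Proof.
move=> ei jS /andP[k12 k2N] h1; apply/negP => h2.
have [eN _ ef] := earlyP ei jS.
have e0 : state (bp i j) 0 = 1%N by rewrite state0 status_bpt.
rewrite -state_exposed in h1; rewrite -state_exposed in h2; move/eqP: h2 => h2.
move: ef; rewrite (@flips_cat _ w _ 0 k2 N) // (@flips_cat _ w _ 0 k1 k2) //.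
have [a1 a2] := @flips_state _ w (bp i j) 0 k1 isT.
have [b1 b2] := @flips_state _ w (bp i j) k1 k2 k12.
have [c1 c2] := @flips_state _ w (bp i j) k2 N k2N.
by move/eqP: h1; lia.
Qed.

(** The first point of block i is at position 1 at time t, so that all the
    points on its left are covered and the next uncovering is by x_0, and has
    moved away from 1 at the later time s. *)
Definition excursion i t s := [/\ (i < B)%N, early i, (t <= s < T)%N, pos (bp i 0) t = 1 &
  exposed (bp i 0) s /\ 2 <= pos (bp i 0) s].

(** The first n + 1 points of the block are finally the left end, then the
    carets of a right comb, each of them just after the left end of the next.
    By last_cover the comb was covered from right to left, and since no point
    was covered twice, all its points were exposed together just before. The
    last of them was at position at most n + 1, hence the first one was at
    position 1. When the first one was covered, it was not at position 1, as
    otherwise it would have come to the left spine. *)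
Lemma early_excursion i : (i < B)%N -> early i -> exists t s, excursion i t s.
Proof.
move=> iB ei.
have nN j : (j < S)%N -> ~~ exposed (bp i j) N.
  by move=> jS; rewrite -state_exposed; have [-> _ _] := earlyP ei jS.
have th j : (j < n)%N -> exists k, [/\ (k < N)%N, exposed (bp i j.+1) k,
    (forall k', (k < k' <= N)%N -> ~~ exposed (bp i j.+1) k') &
    exists i0, [/\ (i0 <= n)%N, pos (bp i j.+1) k = i0%:R + 1 &
                   pos (bp i j) k = i0%:R]].
  move=> jn; have jS : (j.+1 < S)%N by lia.
  have n0 : exposed (bp i j.+1) 0 by rewrite exposed0 natr_nat.
  have [k [/andP[_ kN] hk hk']] := last_change (leq0n N) n0 (nN _ jS).
  exists k; split=> //; have [v hv] := caps iB jn.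
  have [i0 [i0w h1 h2]] := last_cover kN hk hk' hv.
  by exists i0; split=> //; apply: w_n i0w.
have [|tau [tauN hn hn' [i0 [i0n pn _]]]] := th n.-1; first lia.
rewrite prednK // in hn hn' pn.
(* From right to left, the points of the comb are exposed at time tau. *)
have key d : (d <= n)%N ->
    exposed (bp i (n - d)) tau /\ pos (bp i (n - d)) tau + d%:R <= n.+1%:R.
  elim: d => [|d IH] dn.
    by rewrite subn0; split=> //; rewrite pn addr0 natr1 ler_nat.
  have [|ha hp] := IH; first lia.
  have e : (n - d)%N = (n - d.+1).+1 by lia.
  have [|k [kN hk hk' [i1 [_ p1 p0]]]] := th (n - d.+1)%N; first lia.
  rewrite e in ha hp.
  have tk : (tau <= k)%N.
    rewrite leqNgt; apply/negP => kt.
    have ktN : (k < tau <= N)%N by rewrite kt ltnW.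
    by have := hk' _ ktN; rewrite ha.
  have h0 : exposed (bp i (n - d.+1)) tau.
    apply: contraT => hh.
    have dS : (n - d.+1 < S)%N := leq_ltn_trans (leq_subr _ _) nS.
    have tkN : (tau <= k <= N)%N by rewrite tk ltnW.
    by have := stays_covered ei dS tkN hh; rewrite /exposed_at p0 natr_nat.
  split=> //; apply: le_trans hp.
  have : pos (bp i (n - d.+1)) tau + 1 <= pos (bp i (n - d.+1).+1) tau.
    by apply: nat_lt1 => //; rewrite (pos_lt w) ltr_nat ltnS addnS.
  by rewrite -(natr1 d); lra.
have [h0 p0] := key n (leqnn n); rewrite subnn in h0 p0.
have p1 : pos (bp i 0) tau = 1.
  apply/eqP; rewrite eq_le; apply/andP; split.
    by move: p0; rewrite -natr1 => p0; lra.
  have : 0 < pos (bp i 0) tau by rewrite pos_gt0 ltr0n.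
  by case/natrP: h0 => a ->; rewrite ltr0n ler1n.
have S0 : (0 < S)%N by lia.
have [s [/andP[ts sN] hs hs']] := last_change (ltnW tauN) h0 (nN 0%N S0).
exists tau, s; split=> //.
- rewrite ts /= ltnNge; apply/negP => Ts.
  have [_ eT _] := earlyP ei (ltn_trans n_gt0 nS).
  have TsN : (T <= s <= N)%N by rewrite Ts ltnW.
  by have := stays_covered ei S0 TsN (negbT eT); rewrite hs.
- split=> //; have [|a [aw pa e]] := cover_step hs; first by apply: hs'; lia.
  case: a aw pa e => [|a] aw pa e; last first.
    by rewrite pa -natr1; have := ler0n R a; lra.
  have [eN _ ef] := earlyP ei (ltn_trans n_gt0 nS).
  have se : state (bp i 0) s.+1 = 0%N.
    apply/eqP; rewrite /state_at status0 e pa add0r act01 ?ltr01 ?ler1n //.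
    by apply/asboolP; exists 0%N; rewrite expr1 mul1r.
  have e0 : state (bp i 0) 0 = 1%N by rewrite state0 status_bpt.
  move: ef; rewrite (@flips_cat _ w _ 0 s.+1 N) //.
  have [a1 a2] := @flips_state _ w (bp i 0) 0 s.+1 isT.
  have [c1 c2] := @flips_state _ w (bp i 0) s.+1 N sN.
  by clear -a2 a1 c1 c2 se e0 eN; lia.
Qed.

(** The point is the one of germ_peak for the part of the word between u
    and v; it leaves the left spine because e has left position 1. *)
Lemma excursion_loop e u s v : pos e u = 1 -> (u <= s <= v)%N -> 2 <= pos e s ->
  exists x s', [/\ 0 < x, x < e, state x u = 0%N & (u <= s' <= v)%N /\
    state x s' = 1%N /\ exists j, pos x v = 2^-1 ^+ j].
Proof.
move=> eu /andP[us sv] es.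
have seg t k : (k <= v - u)%N ->
    pos t (u + k) = actw (take k (take (v - u) (drop u w))) (pos t u).
  move=> kv; rewrite take_takel // /pos_at -actw_cat; congr (actw _ t).
  by rewrite takeD.
have [M [j [hj [k kw jk]]]] := germ_peak R (take (v - u) (drop u w)).
have {}kw : (k <= v - u)%N by apply: leq_trans kw _; rewrite size_take_min geq_minl.
have M0 : (0 < M)%N.
  rewrite lt0n; apply/eqP => M0.
  have : pos e s = 2^-1 ^+ j (s - u)%N.
    rewrite -{1}(subnKC us) seg ?eu; last by rewrite leq_sub2r.
    by have := hj 0%N (s - u)%N; rewrite M0 !addn0 expr0.
  by move=> h; have := halfX_le1 R (j (s - u)%N); lra.
have [x hx] := actw_surj (take u w) (2^-1 ^+ M : R).
have hxj k' : (k' <= v - u)%N -> pos x (u + k') = 2^-1 ^+ j k'.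
  by move=> kv; rewrite seg // /pos_at hx; have := hj 0%N k'; rewrite !addn0.
exists x, (u + k)%N; split.
- by rewrite -(pos_gt0 w _ u) /pos_at hx halfX_gt0.
- rewrite -(pos_lt w _ _ u) eu /pos_at hx -(prednK M0); exact: lpt_lt1.
- by apply/eqP; rewrite /state_at status0 /pos_at hx; apply/asboolP;
    exists M.-1; rewrite prednK.
split; first lia; split; last by exists (j (v - u)%N); rewrite -hxj // subnKC //; lia.
by apply/eqP; rewrite state_exposed /exposed_at hxj // jk expr0 nat_num1.
Qed.

Lemma bp_lt_zp i j : (i < B)%N -> (j < S)%N -> bp i j < zp.
Proof.
move=> iB jS; have : (i * S + j < i.+1 * S)%N by lia.
have : (i.+1 * S <= B * S)%N by rewrite leq_mul2r; apply/orP; right; lia.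
by rewrite ltr_nat; lia.
Qed.

Lemma state_half x k j : pos x k = 2^-1 ^+ j -> state x k = (j == 0%N).
Proof.
case: j => [|j] e; apply/eqP; first by rewrite state_exposed /exposed_at e expr0 nat_num1.
by rewrite /state_at status0 e; apply/asboolP; exists j.
Qed.

(** Excursions of distinct early blocks happen one after the other: when a
    block begins its excursion, at position 1, the previous blocks are covered,
    and so is the loop point of the previous excursion, which lies on the left
    spine again. *)
Lemma early_loops_by b : (b <= B)%N -> count early (iota 0 b) = 0%N \/
  exists i t s, [/\ excursion i t s, (i < b)%N & loops_by t (count early (iota 0 b)).-1].
Proof.
have S0 : (0 < S)%N by lia.
elim: b => [|b IH] bB; first by left.
rewrite -addn1 iotaD count_cat /= add0n addn0.
have {}IH := IH (ltnW bB).
case eb: (early b); last first.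
  rewrite addn0; case: IH => [->|[i [t [s [h1 h2 h3]]]]]; first by left.
  by right; exists i, t, s; split=> //; lia.
right; have [t' [s' hb]] := early_excursion bB eb; exists b, t', s'; split=> //.
  by rewrite addn1.
rewrite !addn1 /=; case: IH => [->|[i [t [s [hi ib hI]]]]].
  by apply: (@loops_by_later 0); last exact: loops_by0.
have [iB ei tsT et [ns es]] := hi; have [_ _ tsT' et' _] := hb.
have eib : bp i 0 < bp b 0.
  by rewrite ltr_nat ltnS !addn0 ltn_pmul2r.
have lt_s : (s < t')%N.
  rewrite ltnNge; apply/negP => t's.
  have tsN : (t' <= s <= N)%N by rewrite t's; lia.
  have : ~~ exposed (bp i 0) s.
    apply: (stays_covered ei S0 tsN); apply/negP; rewrite /exposed_at.
    rewrite (@nat_between _ 0) ?pos_gt0 ?ltr0n // add0r -et'.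
    by rewrite (pos_lt w).
  by rewrite ns.
have usv : (t <= s <= t')%N by lia.
have [x [s1 [x0 xe xt [hs1 [xs [j xj]]]]]] := excursion_loop et usv es.
have xb : x < bp b 0 by apply: lt_trans eib.
have j0 : (j == 0%N) = false.
  apply/negP => /eqP j0; move: xb; rewrite -(pos_lt w _ _ t') et' xj j0 expr0.
  by rewrite ltxx.
have cE : (count early (iota 0 b)).-1.+1 = count early (iota 0 b).
  rewrite prednK // -has_count; apply/hasP; exists i => //.
  by rewrite mem_iota.
rewrite -cE; apply: (loops_by_add hs1 x0 _ xt xs _ hI).
  by apply: lt_trans (bp_lt_zp bB S0).
by rewrite (state_half xj) j0.
Qed.

Lemma early_loops : loops_before_T (count early (iota 0 B)).
Proof.
have S0 : (0 < S)%N by lia.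
case: (early_loops_by (leqnn B)) => [->|[i [t [s [hi iB hI]]]]].
  by apply: loops_before_TW; apply: (@loops_by_later 0); last exact: loops_by0.
have [_ ei tsT et [ns es]] := hi.
have usv : (t <= s <= T)%N by lia.
have [x [s1 [x0 xe xt [hs1 [xs [j xj]]]]]] := excursion_loop et usv es.
have cE : (count early (iota 0 B)).-1.+1 = count early (iota 0 B).
  rewrite prednK // -has_count; apply/hasP; exists i => //.
  by rewrite mem_iota.
have xz : x < zp by apply: lt_trans (bp_lt_zp iB S0).
rewrite -cE; have := state_half xj; case: (j == 0%N) => /= xT.
  exact: (loops_before_T_open hs1 x0 xz xt xs xT hI).
by apply: loops_before_TW; apply: (loops_by_add hs1 x0 xz xt xs xT hI).
Qed.

Definition slack (t : R) : nat := (status t == 1%N) && has_slack t.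

(** The same count as for words that go left first, with two more flips for
    each block of all_inner: they come from a point with slack, or else from
    the loop of the block, which is early. *)
Lemma right_first_bound :
  (\sum_(t <- ps) right_first_cost (status t) (state t N) +
   2 * count all_inner (iota 0 B) + 1
    <= N + 2 * n)%N.
Proof.
have [Q [l [m [uQ sQ hQ hc h]]]] := early_loops.
have zuQ : uniq (zp :: Q).
  by rewrite /= uQ andbT; apply/negP => /hQ[_]; rewrite ltxx.
have := flips_count w zuQ; rewrite big_cons.
have := @exposed_count R w Q zp T n uQ hQ zT.
have := flips_z zN.
have hpt t : t \in Q ->
    ((t \in ps) * (right_first_cost (status t) (state t N) + 2 * slack t) +
     2 * (l t + m t) <= flips t 0 N + 2 * exposed t T)%N.
  move=> _; have [h1 h2 h3 h4 h5] := h t.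
  have E0 := state0 w t.
  have TN : (T <= N)%N by lia.
  have T'N : (T' <= N)%N by lia.
  have TT1 : (T <= T')%N by lia.
  have [b1 b2] := @flips_state _ w t T T' TT1.
  have [c1 c2] := @flips_state _ w t T' N T'N.
  have hN := state_le2 w t N; have hT := state_le2 w t T.
  have fE : flips t 0 N = (flips t 0 T + flips t T T' + flips t T' N)%N.
    by rewrite (@flips_cat _ w t 0 T N) ?(@flips_cat _ w t T T' N) ?addnA.
  case tp: (t \in ps); last first.
    rewrite mul0n -state_exposed; rewrite E0 in h1 h2 h3 h5.
    have [l0|l0] := posnP (l t); have [m0|m0] := posnP (m t); try (have := h3 l0);
      try (have [] := h5 m0); try move=> ->; rewrite ?eqxx; lia.
  have s0 := status_pts tp.
  have s' : (0 < state t T')%N.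
    apply: state_ge1; apply: le_trans lT' _.
    by rewrite leNgt (pos_lt w) -leNgt (pts_ge D0 tp).
  rewrite mul1n /slack /has_slack -state_exposed.
  have := h t; rewrite E0 => h0; rewrite fE.
  apply: (right_first_cost_le s0 hT s' hN h0) => //; first by case: (_ && _).
  rewrite lt0b => /andP[/eqP -> /andP[/eqP -> /orP[/eqP ->|->]]].
    by split=> //; left.
  by split=> //; right.
have hsum : (\sum_(t <- ps) (right_first_cost (status t) (state t N) + 2 * slack t) +
    2 * \sum_(t <- Q) (l t + m t) <= \sum_(t <- Q) flips t 0 N +
    2 * \sum_(t <- Q) exposed t T)%N.
  have -> : (\sum_(t <- ps) (right_first_cost (status t) (state t N) + 2 * slack t) =
    \sum_(t <- Q) (t \in ps) * (right_first_cost (status t) (state t N) + 2 * slack t))%N.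
    have /= /andP[_ ups] := zpts_uniq R n S B D.
    have pE : perm_eq ps [seq t <- Q | t \in ps].
      apply: uniq_perm; rewrite ?filter_uniq // => t; rewrite mem_filter.
      by case tp: (t \in ps) => //=; rewrite (sQ _ tp).
    rewrite (perm_big _ pE) big_filter big_mkcond /=; apply: eq_bigr => t _.
    by case: (t \in ps); rewrite ?mul1n ?mul0n.
  rewrite !big_distrr /= -!big_split /= big_seq [leqRHS]big_seq.
  exact: leq_sum.
rewrite big_split -big_distrr /= in hsum.
suff : (count all_inner (iota 0 B) <= \sum_(t <- ps) slack t + count early (iota 0 B))%N.
  by lia.
suff : (count all_inner (iota 0 B) <=
        \sum_(t <- bpts R S B) slack t + count early (iota 0 B))%N.
  by rewrite !big_cat /=; lia.
rewrite big_allpairs_dep -(sum1_count _ all_inner) -(sum1_count _ early).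
rewrite [leqLHS]big_mkcond [X in (_ <= _ + X)%N]big_mkcond /= -big_split /=.
rewrite big_seq [leqRHS]big_seq; apply: leq_sum => i _.
case ai: (all_inner i) => //; case ei: (early i); rewrite ?leq_addl //.
move/negbT: ei; rewrite /early ai /= negbK => /hasP[j jS cj].
rewrite addn0 (big_rem j) //= /slack status_bpt cj; lia.
Qed.

End RightFirst.

(** * The sum of both costs, and the two words *)
Definition letters_le n (w : word nat) := all (fun a : letter nat => (a.1 <= n)%N) w.

Section Ridge.
Variable R : archiRealFieldType.
Variables n S B D : nat.
Hypothesis nS : (n < S)%N.

Lemma sum_ge (I : eqType) (r : seq I) (F : I -> nat) c :
  (forall i, i \in r -> (c <= F i)%N) -> (size r * c <= \sum_(i <- r) F i)%N.
Proof.
move=> h; elim: r h => [|i r IH] h; first by rewrite mul0n.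
rewrite big_cons mulSn leq_add ?IH ?h ?mem_head // => j jr.
by apply: h; rewrite inE jr orbT.
Qed.

(** A point that starts exposed and ends up covered off the left spine
    costs 2 in both orders together, and every other point costs at least 4. So
    the blocks below 2 * S + 2 are those of all_inner. *)
Lemma cost_sum (w : word nat) :
  (forall j, (j < n)%N -> exposed_at w (bpt R S B j) (size w)) ->
  (4 * D + B * (2 * S + 2) + 4 * n <=
   \sum_(t <- pts R n S B D) right_first_cost (status t) (state_at w t (size w)) +
   \sum_(t <- pts R n S B D) left_first_cost (status t) (state_at w t (size w)) +
   2 * count (all_inner R S w) (iota 0 B))%N.
Proof.
move=> hf; rewrite -big_split /= /pts !big_cat /=.
set c := fun t : R => (right_first_cost (status t) (state_at w t (size w)) +
                       left_first_cost (status t) (state_at w t (size w)))%N.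
change (4 * D + B * (2 * S + 2) + 4 * n <= \sum_(t <- lpts R D) c t +
  (\sum_(t <- bpts R S B) c t + \sum_(t <- fpts R n S B) c t) +
  2 * count (all_inner R S w) (iota 0 B))%N.
have h1 : (D * 4 <= \sum_(t <- lpts R D) c t)%N.
  rewrite -{1}(size_iota 0 D) -(size_map (lpt R)); apply: sum_ge => t /mapP[j _ ->].
  rewrite /c status_lpt; have := state_le2 w (lpt R j) (size w).
  by case: state_at => [|[|[|]]].
have h2 : (n * 4 <= \sum_(t <- fpts R n S B) c t)%N.
  rewrite -{1}(size_iota 0 n) -(size_map (bpt R S B)).
  apply: sum_ge => t /mapP[j]; rewrite mem_iota => jn ->; rewrite /c status_bpt.
  by have := hf j jn; rewrite -state_exposed => /eqP ->.
suff : (B * (2 * S + 2) <= \sum_(t <- bpts R S B) c t +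
                           2 * count (all_inner R S w) (iota 0 B))%N by lia.
rewrite big_allpairs_dep -sum1_count [X in (_ + 2 * X)%N]big_mkcond big_distrr /=.
rewrite -big_split -{1}(size_iota 0 B); apply: sum_ge => i _ /=.
have c2 j : (2 <= c (bpt R S i j))%N.
  rewrite /c status_bpt; have := state_le2 w (bpt R S i j) (size w).
  by case: state_at => [|[|[|]]].
have hS : (S * 2 <= \sum_(j <- iota 0 S) c (bpt R S i j))%N.
  by rewrite -{1}(size_iota 0 S); apply: sum_ge.
case ai: (all_inner R S w i); first by lia.
move/negbT: ai => /allPn[j jS hj].
have h4 : (4 <= c (bpt R S i j))%N.
  rewrite /c status_bpt; have := state_le2 w (bpt R S i j) (size w).
  by case: state_at hj => [|[|[|]]].
rewrite (big_rem j) //=.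
have : (size (rem j (iota 0 S)) * 2 <=
        \sum_(k <- rem j (iota 0 S)) c (bpt R S i k))%N by apply: sum_ge.
rewrite size_rem // size_iota; rewrite mem_iota in jS.
by move: (\sum_(_ <- rem _ _) _)%N => x; lia.
Qed.
End Ridge.

Section Words.
Variable R : archiRealFieldType.
Local Notation isnat q := (q \is a Num.nat).
Implicit Types (q r : R).

(** Powers of x_0 and of its inverse. *)
Definition up k : word nat := nseq k (0%N, false).
Definition dn k : word nat := nseq k (0%N, true).
(** The word x_k^-1 .. x_1^-1 covers k points by a right comb, whereas a
    power of x_1^-1 covers points by a left comb. *)
Fixpoint rcomb k : word nat := if k is k'.+1 then (k, true) :: rcomb k' else [::].
Definition lcomb k : word nat := nseq k (1%N, true).

Lemma actw_cons a w q : actw (a :: w) q = actw w (act a q).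
Proof. by []. Qed.

Lemma act_true i q : act (i, true) q =
  if q <= i%:R then q else if q <= i%:R + 2 then (q + i%:R) / 2 else q - 1.
Proof. by []. Qed.

Lemma dn_small k q : 0 < q -> q <= 2 -> actw (dn k) q = q * 2^-1 ^+ k.
Proof.
elim: k q => [|k IH] q q0 q2; first by rewrite expr0 mulr1.
by rewrite /actw /= -/(actw _ _) act01 // IH ?exprS; [ring|lra|lra].
Qed.

Lemma dn_large k q : k%:R + 1 <= q -> actw (dn k) q = q - k%:R.
Proof.
elim: k q => [|k IH] q; first by rewrite subr0.
rewrite -natr1 => kq; have k0 := ler0n R k.
rewrite /actw /= -/(actw _ _).
have -> : act (0%N, true) q = q - 1.
  by rewrite act_true; do ! case: ifPn; rewrite -?ltNge; lra.
by rewrite IH; lra.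
Qed.

Lemma up_small k q : 0 < q -> q <= 2 -> actw (up k) (q * 2^-1 ^+ k) = q.
Proof.
elim: k => [|k IH] q0 q2; first by rewrite expr0 mulr1.
rewrite /actw /= -/(actw _ _) act00 ?halfX_S; last 2 first.
- by have := halfX_gt0 R k; nra.
- by have := halfX_gt0 R k; have := halfX_le1 R k; nra.
by rewrite (_ : 2 * _ = q * 2^-1 ^+ k) ?IH //; field.
Qed.

Lemma up_large k q : 1 <= q -> actw (up k) q = q + k%:R.
Proof.
elim: k q => [|k IH] q q1; first by rewrite addr0.
rewrite /actw /= -/(actw _ _).
have -> : act (0%N, false) q = q + 1.
  by rewrite /act /= /split_at; do ! case: ifPn; rewrite -?ltNge; lra.
by rewrite IH -?(natr1 k); lra.
Qed.

Lemma rcomb_le1 k q : q <= 1 -> actw (rcomb k) q = q.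
Proof.
by elim: k => // k IH q1; rewrite /actw /= -/(actw _ _) act_le1 // IH.
Qed.

Lemma rcomb_large k q : k%:R + 2 <= q -> actw (rcomb k) q = q - k%:R.
Proof.
elim: k q => [|k IH] q; first by rewrite subr0.
rewrite -natr1 => kq; have k0 := ler0n R k; rewrite /actw /= -/(actw _ _).
have -> : act (k.+1, true) q = q - 1.
  rewrite act_true -natr1; do ! case: ifPn; rewrite -?ltNge; try lra.
by rewrite IH; lra.
Qed.

Lemma rcomb_top k r : 0 <= r -> r <= 1 ->
  actw (rcomb k) (k%:R + 1 + r) = 2 - (1 - r) * 2^-1 ^+ k.
Proof.
elim: k r => [|k IH] r r0 r1; first by rewrite /actw /= expr0; lra.
rewrite /actw /= -/(actw _ _) -natr1.
have -> : act (k.+1, true) (k%:R + 1 + 1 + r) = k%:R + 1 + (1 + r) / 2.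
  by rewrite act_true -natr1; do ! case: ifPn; rewrite -?ltNge; lra.
by rewrite IH ?halfX_S; [field|lra|lra].
Qed.

Lemma rcomb_nat k j : (j <= k)%N ->
  actw (rcomb k) (j%:R + 1) = 2 - 2^-1 ^+ j :> R.
Proof.
elim: k => [|k IH] jk.
  have -> : j = 0%N by lia.
  by rewrite /actw /= expr0; lra.
have [jk'|jk'] := leqP j k.
  rewrite /actw /= -/(actw _ _) act_true natr1 ler_nat ltnS jk' -natr1.
  exact: IH.
have -> : j = k.+1 by lia.
by rewrite -[k.+1%:R + 1]addr0 rcomb_top ?lexx ?ler01 // subr0 mul1r.
Qed.

Lemma lcomb_le1 k q : q <= 1 -> actw (lcomb k) q = q.
Proof. by elim: k => // k IH q1; rewrite /actw /= -/(actw _ _) act_le1 // IH. Qed.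

Lemma lcomb_small k q : 1 <= q -> q <= 2 ->
  actw (lcomb k) q = 1 + (q - 1) * 2^-1 ^+ k.
Proof.
elim: k q => [|k IH] q q1 q2; first by rewrite /actw /= expr0; lra.
rewrite /actw /= -/(actw _ _).
have -> : act (1%N, true) q = (q + 1) / 2.
  by rewrite act_true; do ! case: ifPn; rewrite -?ltNge; lra.
by rewrite IH ?halfX_S; [field|lra|lra].
Qed.

Lemma lcomb_large k q : k%:R + 2 <= q -> actw (lcomb k) q = q - k%:R.
Proof.
elim: k q => [|k IH] q; first by rewrite subr0.
rewrite -natr1 => kq; have k0 := ler0n R k; rewrite /actw /= -/(actw _ _).
have -> : act (1%N, true) q = q - 1.
  by rewrite act_true; do ! case: ifPn; rewrite -?ltNge; lra.
by rewrite IH; lra.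
Qed.

Variables n K B D : nat.
Hypothesis n_gt0 : (0 < n)%N.
Hypothesis D2 : (2 <= D)%N.
(** Covers the points of a block, its first point excepted, by a right comb
    of n carets with a left comb of K carets above it, then covers the first
    point on the left spine. The left comb protects the right comb from being
    destroyed by K letters. *)
Definition block_word : word nat := rcomb n ++ lcomb K ++ [:: (0%N, true)].
Local Notation S := (n + K + 1)%N.
Definition block_words b : word nat := flatten (nseq b block_word).
(** Goes to the right, builds all the blocks and covers the last point. *)
Definition right_word : word nat := block_words B ++ [:: (n, true)].
(** Goes to the left end, changes the order of the last two carets there,
    and comes back. *)
Definition left_word : word nat := up D ++ (1%N, true) :: dn (D - 1).
(** The element x does the work on the right first. At the end it stands
    one step short of where it started, with the point 1/2 exposed. *)
Definition word_x : word nat := right_word ++ up (B + D) ++ (1%N, true) :: dn (D - 2).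
(** The element y does the work on the left first, and ends one step on the
    other side of where it started, with the first point of the first block on
    the left spine. *)
Definition word_y : word nat := left_word ++ right_word ++ up (B - 1).

Lemma block_word_small q : 0 < q -> q <= 1 -> actw block_word q = q / 2.
Proof.
move=> q0 q1; rewrite /block_word !actw_cat rcomb_le1 // lcomb_le1 //.
by rewrite /actw /= act01 //; lra.
Qed.

Lemma block_word_large q : S%:R + 1 <= q -> actw block_word q = q - S%:R.
Proof.
rewrite !natrD => h; have n0 := ler0n R n; have K0 := ler0n R K.
rewrite /block_word !actw_cat rcomb_large; last by lra.
rewrite lcomb_large; last by lra.
by rewrite /actw /= act_true; do ! case: ifPn; rewrite -?ltNge; lra.
Qed.

(** The position of the j-th point of a block inside the tree of the
    block; for j = 0 this is the left end of that tree. *)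
Definition tooth j : R := 1 + (1 - 2^-1 ^+ j) * 2^-1 ^+ K.

Lemma tooth_bounds j : 1 <= tooth j /\ tooth j <= 2.
Proof.
rewrite /tooth; have := halfX_gt0 R j; have := halfX_le1 R j.
have := halfX_gt0 R K; have := halfX_le1 R K; move: (_ ^+ j) (_ ^+ K) => a b.
by move=> *; split; nra.
Qed.

Lemma block_word_tooth j : (j <= n)%N -> actw block_word (j%:R + 1) = tooth j / 2.
Proof.
move=> jn; rewrite /block_word !actw_cat rcomb_nat //.
have := halfX_gt0 R j; have := halfX_le1 R j => h1 h2.
rewrite lcomb_small; [|lra|lra].
have [t1 t2] := tooth_bounds j.
rewrite (_ : 1 + _ = tooth j); last by rewrite /tooth; ring.
by rewrite /actw /= act01 //; lra.
Qed.

Lemma block_words_small b q : 0 < q -> q <= 1 -> actw (block_words b) q = q * 2^-1 ^+ b.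
Proof.
elim: b q => [|b IH] q q0 q1; first by rewrite expr0 mulr1.
rewrite /block_words /= actw_cat block_word_small // -/(block_words b).
by rewrite IH ?exprS; [ring|lra|lra].
Qed.

Lemma block_words_large b q : (b * S)%:R + 1 <= q ->
  actw (block_words b) q = q - (b * S)%:R.
Proof.
elim: b q => [|b IH] q; first by rewrite mul0n subr0.
rewrite mulSn [in (_ + _)%:R]natrD => h; have b0 := ler0n R (b * S).
by rewrite /block_words /= actw_cat block_word_large -/(block_words b) ?IH; lra.
Qed.

Lemma block_words_tooth b i j : (i < b)%N -> (j <= n)%N ->
  actw (block_words b) (bpt R S i j) = tooth j * 2^-1 ^+ (b - i).
Proof.
move=> + jn; elim: b i => // b IH [|i] ib;
  rewrite /block_words /= actw_cat -/(block_words b).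
  rewrite /bpt mul0n add0n -natr1 block_word_tooth //; have [t1 t2] := tooth_bounds j.
  by rewrite block_words_small ?subn0 ?exprS; [field|lra|lra].
rewrite block_word_large; last by rewrite /bpt natr1 ler_nat; lia.
rewrite subSS -IH // /bpt mulSn -addnA -addnS natrD [_ + _ - _]addrC addKr //.
Qed.

Lemma word_x_small q : 0 < q -> q <= 1 ->
  actw word_x q = actw (up (B + D) ++ (1%N, true) :: dn (D - 2)) (q * 2^-1 ^+ B).
Proof.
move=> q0 q1; rewrite /word_x /right_word -!catA !actw_cat block_words_small //.
congr (actw _ (actw _ _)).
rewrite {1}/actw /= act_le1 //.
by have := halfX_gt0 R B; have := halfX_le1 R B; nra.
Qed.

Lemma word_x_gap0 : actw word_x (lpt R D.-1) = 2^-1 ^+ (D - 2).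
Proof.
rewrite word_x_small ?halfX_gt0 ?halfX_le1 // /lpt prednK; last by lia.
rewrite -exprD (addnC D) -[2^-1 ^+ (B + D)]mul1r actw_cat up_small ?ler1n //.
by rewrite actw_cons act_le1 // dn_small ?ler1n // mul1r.
Qed.

Lemma word_x_gap1 : actw word_x (lpt R (D - 2)) = 2^-1 ^+ (D - 2) + 2^-1 ^+ (D - 2).+1.
Proof.
rewrite word_x_small ?halfX_gt0 ?halfX_le1 // /lpt -exprD actw_cat.
rewrite (_ : 2^-1 ^+ ((D - 2).+1 + B) = 2 * 2^-1 ^+ (B + D)); last first.
  have -> : (B + D = (((D - 2).+1 + B)).+1)%N by lia.
  by rewrite [X in 2 * X]halfX_S; field.
rewrite up_small ?ltr0n // actw_cons.
have -> : act (1%N, true) 2 = 3 / 2 :> R.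
  by rewrite act_true; do ! case: ifPn; rewrite -?ltNge; lra.
by rewrite dn_small ?halfX_S; [field|lra|lra].
Qed.

Lemma finish_large q : 1 <= q ->
  actw (up D ++ (1%N, true) :: dn (D - 2)) q = q + 1.
Proof.
move=> q1; have D2' : 2 <= D%:R :> R by rewrite (ler_nat _ 2).
rewrite actw_cat up_large // actw_cons.
have -> : act (1%N, true) (q + D%:R) = q + D%:R - 1.
  by rewrite act_true; do ! case: ifPn; rewrite -?ltNge; lra.
by rewrite dn_large natrB //; lra.
Qed.

Lemma right_word_tooth i j : (i < B)%N -> (j <= n)%N ->
  actw right_word (bpt R S i j) = tooth j * 2^-1 ^+ (B - i).
Proof.
move=> iB jn; have [t1 t2] := tooth_bounds j.
rewrite /right_word actw_cat block_words_tooth // /actw /= act_le1 //.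
have -> : (B - i = (B - i).-1.+1)%N by lia.
rewrite halfX_S; have h0 := halfX_gt0 R (B - i).-1; have h1 := halfX_le1 R (B - i).-1.
have : tooth j * 2^-1 ^+ (B - i).-1 <= 2 * 1 by apply: ler_pM; lra.
by lra.
Qed.

Lemma word_x_tooth i j : (i < B)%N -> (j <= n)%N ->
  actw word_x (bpt R S i j) = tooth j + i%:R + 1.
Proof.
move=> iB jn; have [t1 t2] := tooth_bounds j.
rewrite /word_x actw_cat right_word_tooth //.
have -> : up (B + D) = up (B - i) ++ up i ++ up D.
  by rewrite /up -!nseqD; congr nseq; lia.
rewrite -!catA actw_cat up_small; [|lra|lra].
rewrite actw_cat up_large // finish_large //.
by have := ler0n R i; lra.
Qed.

Lemma right_word_far q : 1 <= q -> actw right_word ((B * S)%:R + q) = act (n, true) q.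
Proof.
move=> q1; rewrite /right_word actw_cat block_words_large; last by lra.
by rewrite [_ + q]addrC addrK.
Qed.

Lemma word_x_far q : 1 <= q ->
  actw word_x ((B * S)%:R + q) = act (n, true) q + B%:R + 1.
Proof.
move=> q1; have q1' : 1 <= act (n, true) q.
  have n1 : 1 <= n%:R :> R by rewrite ler1n.
  by rewrite act_true; do ! case: ifPn; rewrite -?ltNge; lra.
rewrite /word_x actw_cat right_word_far //.
have -> : up (B + D) = up B ++ up D by rewrite /up -nseqD.
rewrite -catA actw_cat up_large // finish_large //.
by have := ler0n R B; lra.
Qed.

Lemma size_block_words b : size (block_words b) = (b * S)%N.
Proof.
have szc k : size (rcomb k) = k by elim: k => //= k ->.
elim: b => // b IH; rewrite /block_words /= size_cat -/(block_words b) IH /block_word.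
by rewrite !size_cat szc size_nseq /=; lia.
Qed.

Lemma size_word_x : size word_x = (2 * D + B * (S + 1))%N.
Proof. by rewrite /word_x /right_word !size_cat /= size_block_words !size_nseq; nia. Qed.

Lemma size_word_y : (0 < B)%N -> size word_y = (2 * D + B * (S + 1))%N.
Proof.
move=> B0; rewrite /word_y /right_word /left_word !size_cat /= size_block_words.
by rewrite !size_nseq; nia.
Qed.

Lemma letters_block_words b : letters_le n (block_words b).
Proof.
have cn k : (k <= n)%N -> letters_le n (rcomb k).
  by elim: k => //= k IH kn; rewrite kn IH // ltnW.
elim: b => // b IH; rewrite /block_words /letters_le /= all_cat [X in _ && X]IH andbT.
by rewrite /block_word !all_cat [X in X && _]cn //= !all_nseq /= n_gt0 orbT.
Qed.

Lemma letters_word_x : letters_le n word_x.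
Proof.
rewrite /word_x /right_word /letters_le !all_cat [X in X && _ && _]letters_block_words /=.
by rewrite !all_nseq /= n_gt0 leqnn !orbT.
Qed.

Lemma letters_word_y : letters_le n word_y.
Proof.
rewrite /word_y /right_word /left_word /letters_le !all_cat.
rewrite [X in _ && (X && _ && _)]letters_block_words /=.
by rewrite /= !all_nseq /= n_gt0 leqnn !orbT.
Qed.

End Words.

(** * Elements close to the first word *)
Section Near.
Variable R : archiRealFieldType.
Local Notation isnat q := (q \is a Num.nat).
Implicit Types (q r : R).

(** The carets above q protect it from as many letters. *)
Lemma mid_of_actw u v q l : (size u <= v)%N -> mid_of v q l ->
  exists v', mid_of v' (actw u q) (actw u l).
Proof.
elim: u v q l => [|a u IH] v q l /= uv h; first by exists v.
case: v uv h => // v uv h.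
have [v' [vv' h']] := @mid_of_act_deep _ v q l a h.
by apply: (IH v') => //; apply: leq_trans vv'.
Qed.

(** Letters of index at most n only translate the points beyond n + 2. *)
Lemma far_actw n u q : letters_le n u -> n%:R + 2 + (size u)%:R <= q ->
  isnat (actw u q) = isnat q.
Proof.
elim: u q => // a u IH q /= /andP[an un]; rewrite -natr1 => h.
have u0 := ler0n R (size u); have n0 := ler0n R n.
have an' : a.1%:R <= n%:R :> R by rewrite ler_nat.
have [h1 h2] : isnat (act a q) = isnat q /\ n%:R + 2 + (size u)%:R <= act a q.
  case: a an an' {IH} => i [] /= _ an'; rewrite /act /=.
    have -> : merge_at i q = q - 1.
      by rewrite /merge_at; do ! case: ifPn; rewrite -?ltNge; lra.
    by split; [apply: isnat_subr1; lra | lra].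
  have -> : split_at i q = q + 1.
    by rewrite /split_at; do ! case: ifPn; rewrite -?ltNge; lra.
  by split; [apply: isnat_addr1; lra | lra].
by rewrite -h1 -IH.
Qed.

Variables n K B D L : nat.
Hypothesis n_gt0 : (0 < n)%N.
Hypothesis KL : (L <= K)%N.
Hypothesis DL : (L.+2 <= D)%N.
Hypothesis BL : (n + L < B)%N.
Local Notation S := (n + K + 1)%N.
Local Notation zp := (zpt R n S B).
Local Notation wx := (word_x n K B D).
Local Notation wy := (word_y n K B D).
Local Notation gap0 := (lpt R D.-1).
Local Notation gap1 := (lpt R (D - 2)).

Let D2 : (2 <= D)%N. Proof. exact: leq_trans DL. Qed.

(** At time T the last point can be covered, so that almost all the marked
    points are covered; at time T' the leftmost marked point has reached 1, so
    that no marked point is on the left spine. *)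
Definition right_first (w : word nat) := exists T T',
  [/\ (T <= T' <= size w)%N, pos_at w zp T <= n.+1%:R & 1 <= pos_at w gap0 T'].
Definition left_first (w : word nat) := exists T T',
  [/\ (T' <= T <= size w)%N, pos_at w zp T <= n.+1%:R & 1 <= pos_at w gap0 T'].

(** Only the action matters, so w may be any word for the same element. *)
Lemma left_first_cat u v : left_first u -> left_first (u ++ v).
Proof.
case=> T [T' [/andP[h1 h2] h3 h4]]; have h5 := leq_trans h1 h2.
exists T, T'; rewrite /pos_at !takel_cat //; split=> //.
by rewrite h1 size_cat (leq_trans h2) ?leq_addr.
Qed.

Definition near (w : word nat) := exists u,
  [/\ letters_le n u, (size u <= L)%N & forall q, actw w q = actw u (actw wx q)].

Lemma near_z w : near w -> ~~ exposed_at w zp (size w).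
Proof.
case=> u [un uL e]; rewrite /exposed_at pos_size e.
have -> : zp = (B * S)%:R + (n%:R + 1) by rewrite /zpt -natr1 natrD addrA.
rewrite word_x_far //; last by have := ler0n R n; lra.
have -> : act (n, true) (n%:R + 1) = n%:R + 2^-1 :> R.
  by rewrite act_true; do ! case: ifPn; rewrite -?ltNge; lra.
have BL' : n%:R + L%:R + 1 <= B%:R :> R by rewrite -natrD natr1 ler_nat.
have uL' : (size u)%:R <= L%:R :> R by rewrite ler_nat.
rewrite (far_actw un); last by have := ler0n R n; lra.
rewrite isnat_addr1; last by have := ler0n R n; have := ler0n R B; lra.
apply/negP => h.
have := @nat_between R (n + B) (n%:R + 2^-1 + B%:R).
rewrite h natrD => h'; have // : true = false by apply: h'; lra.
Qed.

Lemma near_f w j : near w -> (j < n)%N -> exposed_at w (bpt R S B j) (size w).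
Proof.
case=> u [un uL e] jn; rewrite /exposed_at pos_size e.
have -> : bpt R S B j = (B * S)%:R + (j%:R + 1) by rewrite /bpt -natr1 natrD addrA.
have j0 := ler0n R j.
rewrite word_x_far //; last by lra.
have -> : act (n, true) (j%:R + 1) = j%:R + 1 :> R.
  by rewrite act_true natr1 ler_nat jn.
have BL' : n%:R + L%:R + 1 <= B%:R :> R by rewrite -natrD natr1 ler_nat.
have uL' : (size u)%:R <= L%:R :> R by rewrite ler_nat.
rewrite (far_actw un); last by lra.
by rewrite natr1 -natrD natr1 natr_nat.
Qed.

(** The right comb of each block survives under its left comb. *)
Lemma near_caps w i j : near w -> (i < B)%N -> (j < n)%N ->
  exists v, mid_of v (pos_at w (bpt R S i j.+1) (size w))
                   (pos_at w (bpt R S i j) (size w)).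
Proof.
case=> u [un uL e] iB jn; rewrite !pos_size !e.
rewrite !word_x_tooth //; last exact: ltnW.
apply: (@mid_of_actw _ (K + j)); first by lia.
(* The numerator of tooth j + i + 1 over 2 ^ (K + j). *)
exists ((i + 2) * 2 ^ (K + j) + (2 ^ j - 1))%N.
have hKj := @natX_half R (K + j); have hj := @natX_half R j.
rewrite natrD natrM mulrDl natrB ?expn_gt0 // mulrBl.
rewrite -mulrA hKj /tooth halfX_S halfX_S; move: hj; rewrite exprD.
move: (2 ^ j)%:R (_ ^+ j) (_ ^+ K) => x y z hj.
split; last by field.
have -> : x * (z * y) = z * (x * y) by ring.
by rewrite hj natrD; ring.
Qed.

Lemma near_gap1 w : near w ->
  exists v, mid_of v (pos_at w gap1 (size w)) (pos_at w gap0 (size w)).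
Proof.
case=> u [un uL e]; rewrite !pos_size !e word_x_gap0 // word_x_gap1 //.
apply: (@mid_of_actw _ (D - 2)); first by lia.
by exists 1%N; rewrite mul1r.
Qed.

(** The two leftmost carets of x are in the opposite order of what they were
    initially. So the right one has been exposed, and by last_cover the left one
    was exposed when it was covered for the last time. *)
Lemma near_left w : near w -> exists T', [/\ (T' < size w)%N, exposed_at w gap1 T',
  ~~ exposed_at w gap1 T'.+1 & 1 <= pos_at w gap0 T'].
Proof.
move=> nw; have [v hv] := near_gap1 nw.
have hN : ~~ exposed_at w gap1 (size w) by rewrite /exposed_at (mid_of_nonnat hv).
have [k0 k0N hk0] : exists2 k, (k <= size w)%N & exposed_at w gap1 k.
  case: (pselect (exists2 k, (k <= size w)%N & exposed_at w gap1 k)) => // hno.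
  have [k hk|v' []] := mid_of_back (leq0n (size w)) _ hv.
    by apply/negP => h; apply: hno; exists k => //; lia.
  move=> c; rewrite !pos_0 /lpt (_ : D.-1.+1 = (D - 2).+2); last by lia.
  move: ((D - 2).+1) => d; rewrite !halfX_S => -[h1 h2].
  have := halfX_gt0 R d => d0.
  have : (2 * c)%:R = 1 :> R.
    have h3 : 2^-1 ^+ v' = 2^-1 ^+ d :> R by lra.
    rewrite h3 in h1; rewrite natrM; apply: (mulIf (lt0r_neq0 d0)).
    by rewrite mul1r -mulrA -h1; lra.
  by move/eqP; rewrite pnatr_eq1 => /eqP; lia.
have [k [/andP[_ kN] hk hk']] := last_change k0N hk0 hN.
have [i [_ _ e]] := last_cover kN hk hk' hv.
exists k; split=> //; first by apply: hk'; lia.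
have : 0 < pos_at w gap0 k by rewrite pos_gt0 halfX_gt0.
by rewrite e ltr0n ler1n.
Qed.

Lemma near_right w : letters_le n w -> near w -> exists T, [/\ (T < size w)%N,
  exposed_at w zp T, ~~ exposed_at w zp T.+1 & pos_at w zp T <= n.+1%:R].
Proof.
move=> wn nw; have hN := near_z nw.
have h0 : exposed_at w zp 0 by rewrite exposed0 natr_nat.
have [k [/andP[_ kN] hk hk']] := last_change (leq0n (size w)) h0 hN.
have hk1 : ~~ exposed_at w zp k.+1 by apply: hk'; lia.
have [i [iw pz _]] := cover_step hk hk1.
exists k; split=> //; rewrite pz natr1 ler_nat ltnS.
exact: (allP wn) iw.
Qed.

(** The last covering of the last point and that of the next to leftmost
    point are distinct letters, so one of them comes first. *)
Lemma near_right_or_left_first w : letters_le n w -> near w ->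
  right_first w \/ left_first w.
Proof.
move=> wn nw; have [T' [TN' h1 h2 h3]] := near_left nw.
have [T [TN g1 g2 g3]] := near_right wn nw.
case: (leqP T T') => TT'; [left|right]; exists T, T'; split=> //; lia.
Qed.

(** With m the common length of the two words, this says that an element
    close to x cannot be reached in m letters in one order and in m + 1 letters
    in the other order. *)
Lemma ridge w1 w2 : letters_le n w1 -> near w1 -> right_first w1 -> left_first w2 ->
  (forall q, actw w1 q = actw w2 q) ->
  (2 * (2 * D + B * (S + 1)) + 2 <= size w1 + size w2)%N.
Proof.
move=> wn nw [T1 [T1' [h1 h2 h3]]] [T2 [T2' [g1 g2 g3]]] e.
have D0 : (0 < D)%N by lia.
have nS : (n < S)%N by lia.
have w_n i b : (i, b) \in w1 -> (i <= n)%N by move=> /(allP wn).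
have zN := near_z nw.
have zN2 : ~~ exposed_at w2 zp (size w2) by rewrite /exposed_at pos_size -e -pos_size.
have r1 := right_first_bound n_gt0 nS D0 w_n h1 h2 h3 zN (fun i j => near_caps nw).
have r2 := left_first_bound D0 g1 g2 g3 zN2.
have r3 := @cost_sum R n S B D nS w1 (fun j => near_f nw).
have : (\sum_(t <- pts R n S B D) left_first_cost (status t) (state_at w1 t (size w1)) =
  \sum_(t <- pts R n S B D) left_first_cost (status t) (state_at w2 t (size w2)))%N.
  by apply: eq_bigr => t _; rewrite /state_at !pos_size e.
move: r1 r2 r3 => /=; nia.
Qed.

Lemma word_x_right_first : right_first wx.
Proof.
exists (size (block_words n K B)), (size (right_word n K B ++ up (B + D))); split.
- by rewrite /word_x !size_cat; lia.
- rewrite /pos_at /word_x /right_word -!catA take_size_cat // block_words_large.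
    by rewrite /zpt -addnS natrD addrC addKr.
  by rewrite /zpt natr1 ler_nat ltnS leq_addr.
- rewrite /pos_at /word_x catA take_size_cat // actw_cat /right_word.
  rewrite actw_cat block_words_small ?halfX_gt0 ?halfX_le1 //.
  have h : lpt R D.-1 * 2^-1 ^+ B = 1 * 2^-1 ^+ (B + D).
    by rewrite mul1r /lpt prednK ?(leq_trans _ D2) // -exprD addnC.
  rewrite h {2}/actw /= act_le1 ?mul1r ?halfX_le1 // -[2^-1 ^+ _]mul1r up_small //.
  by rewrite ler1n.
Qed.

Lemma word_y_left_first : left_first wy.
Proof.
exists (size (left_word D ++ block_words n K B)), (size (up D)); split.
- by rewrite /word_y !size_cat; lia.
- have -> : wy = (left_word D ++ block_words n K B) ++ (n, true) :: up (B - 1).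
    by rewrite /word_y /right_word -!catA.
  rewrite /pos_at take_size_cat // actw_cat.
  have -> : actw (left_word D) zp = zp.
    have z1 : 1 <= zp by rewrite ler1n.
    have D2' : 2 <= D%:R :> R by rewrite (ler_nat _ 2).
    rewrite /left_word actw_cat up_large // actw_cons.
    have -> : act (1%N, true) (zp + D%:R) = zp + D%:R - 1.
      by rewrite act_true; do ! case: ifPn; rewrite -?ltNge; lra.
    by rewrite dn_large natrB ?(leq_trans _ D2) //; lra.
  rewrite block_words_large.
    by rewrite /zpt -addnS natrD addrC addKr.
  by rewrite /zpt natr1 ler_nat ltnS leq_addr.
- rewrite /pos_at /word_y /left_word -!catA take_size_cat //.
  rewrite /lpt prednK ?(leq_trans _ D2) // -[2^-1 ^+ _]mul1r up_small //.
  by rewrite ler1n.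
Qed.

End Near.

Close Scope ring_scope.
Local Open Scope group_scope.

(** * The Cayley graph *)
Definition cls (w : word nat) : thompsonF := pres_class thompson_rel w.

Lemma clsM u v : cls u * cls v = cls (u ++ v).
Proof. exact: pres_classM. Qed.

Lemma cls_act u v : cls u = cls v -> actw u =1 (actw v : rat -> rat).
Proof. by move/pres_classP; apply: actw_pres. Qed.

Section Cayley.
Variables (n : nat) (n_gt0 : (0 < n)%N).
Local Notation X := (X_ n_gt0).

Lemma cayley_edgeP h g : reflect
  (exists2 a : letter nat, (a.1 <= n)%N & g = h * cls [:: a]) (cayley_edge X h g).
Proof.
have clsV i : cls [:: (i, true)] = (tx i)^-1.
  by rewrite /tx /pres_gen pres_classV.
apply: (iffP hasP) => [[_ /mapP[i + ->]] | [[i b] /= iN ->]].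
  rewrite mem_iota => iN /orP[/eqP ->|/eqP ->].
    by exists (i, false).
  by exists (i, true); rewrite ?clsV.
exists (tx i); first by rewrite map_f // mem_iota.
by case: b; rewrite ?clsV eqxx ?orbT.
Qed.

Lemma word_path w h : letters_le n w ->
  has_path_of_length X h (h * cls w) (size w).
Proof.
elim: w h => [|a w IH] h /=.
  by exists [::]; rewrite /cls -/(pres_one _) mulg1.
case/andP=> an wn; have [p [pp lp sp]] := IH (h * cls [:: a]) wn.
exists (h * cls [:: a] :: p); split=> /=.
- by rewrite pp andbT; apply/cayley_edgeP; exists a.
- by rewrite lp -mulgA clsM.
- by rewrite sp.
Qed.

Lemma path_word h p : path (cayley_edge X) h p ->
  exists w, [/\ letters_le n w, size w = size p & last h p = h * cls w].
Proof.
elim: p h => [|g p IH] h /=.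
  by exists [::]; split=> //; rewrite /cls -/(pres_one _) mulg1.
case/andP=> /cayley_edgeP[a an ->] /IH[w [wn sw ->]].
by exists (a :: w); rewrite /= an wn sw -mulgA clsM.
Qed.

Lemma word_dist_le w h : letters_le n w -> (word_dist X h (h * cls w) <= size w)%N.
Proof.
move=> wn; rewrite /word_dist; case: ex_minnP => d _; apply.
by apply/asboolP/word_path.
Qed.

Lemma in_ballP m g : reflect
  (exists w, [/\ letters_le n w, (size w <= m)%N & cls w = g]) (in_ball X m g).
Proof.
apply: (iffP idP) => [|[w [wn wm <-]]].
  rewrite /in_ball /word_dist; case: ex_minnP => d /asboolP[p [pp lp sp]] _ dm.
  have [w [wn sw]] := path_word pp; rewrite lp mul1g => gE.
  by exists w; split=> //; rewrite sw sp.
by rewrite /in_ball; apply: leq_trans wm; rewrite -[cls w]mul1g word_dist_le.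
Qed.

End Cayley.

Lemma tx_shift i j : (i < j)%N -> tx j * tx i = tx i * tx j.+1.
Proof. by move=> ij; rewrite -(tx_rel ij) !mulgA mulgV mul1g. Qed.

Lemma tx_shiftV i j : (i < j)%N -> tx j.+1 * (tx i)^-1 = (tx i)^-1 * tx j.
Proof. by move=> ij; rewrite -(tx_rel ij) -!mulgA mulgV mulg1. Qed.

Lemma cls_up k : cls (up k) = tx 0 ^+ k.
Proof.
elim: k => // k IH; rewrite expgS -IH.
by rewrite -[tx 0]/(cls [:: (0%N, false)]) clsM.
Qed.

Lemma cls_true i : cls [:: (i, true)] = (tx i)^-1.
Proof. by rewrite /tx /pres_gen pres_classV. Qed.

Lemma linv_cls a : cls [:: a] * cls [:: linv a] = 1.
Proof. by rewrite clsM; apply/pres_classP/pres_cancel. Qed.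

Lemma cls_dn k : cls (dn k) = tx 0 ^- k.
Proof.
elim: k => [|k IH]; first by rewrite expg0 invg1.
by rewrite expgSr invgM -IH -cls_true clsM.
Qed.

Lemma tx_shiftX k j : (0 < j)%N -> tx j * tx 0 ^+ k = tx 0 ^+ k * tx (j + k).
Proof.
move=> j0; elim: k => [|k IH]; first by rewrite mulg1 mul1g addn0.
rewrite expgSr mulgA IH -!mulgA tx_shift ?addnS //.
by rewrite addn_gt0 j0.
Qed.

Lemma tx_shiftXV k j : (0 < j)%N -> tx (j + k) * tx 0 ^- k = tx 0 ^- k * tx j.
Proof.
move=> j0; apply: (mulgI (tx 0 ^+ k)); rewrite !mulgA -tx_shiftX //.
by rewrite mulgV mul1g -mulgA mulgV mulg1.
Qed.

(** For the action, left_word moves only points of [0, 1]; this is a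
    substitute for being supported on the right of 1. Asking it for all D makes
    it stable under conjugation by x_0, as x_0 turns left_word D into
    left_word D.+1. *)
Definition right_part (g : thompsonF) :=
  forall D, (2 <= D)%N -> commute (cls (left_word D)) g.

Lemma right_partM g h : right_part g -> right_part h -> right_part (g * h).
Proof. by move=> cg ch D D2; apply: commuteM; [apply: cg | apply: ch]. Qed.

Lemma right_partV g : right_part g -> right_part g^-1.
Proof. by move=> cg D D2; apply: commuteV; apply: cg. Qed.

Lemma right_part_tx j : (0 < j)%N -> right_part (tx j).
Proof.
move=> j0 D D2; apply: commute_sym.
rewrite /commute /left_word -clsM -cat1s -clsM cls_up cls_dn cls_true.
rewrite !mulgA tx_shiftX // -!mulgA; congr (_ * _).
have -> : (j + D = (j + D.-1).+1)%N by lia.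
rewrite mulgA tx_shiftV; last by lia.
by rewrite -mulgA subn1 tx_shiftXV.
Qed.

Lemma right_partJ g : right_part g -> right_part ((tx 0)^-1 * g * tx 0).
Proof.
move=> cg D D2; have := cg D.+1 (leqW D2).
have -> : cls (left_word D.+1) = tx 0 * cls (left_word D) * (tx 0)^-1.
  rewrite /left_word -!clsM -!(cat1s _ (dn _)) -!clsM !cls_up !cls_dn expgS -!mulgA.
  do 3! congr (_ * _); have -> : (D.+1 - 1 = (D - 1).+1)%N by lia.
  by rewrite expgS invgM.
rewrite /commute => e; apply: (mulgI (tx 0)); apply: (mulIg (tx 0)^-1).
move: e; rewrite -!mulgA mulgV mulg1 => e.
rewrite [tx 0 * ((tx 0)^-1 * _)]mulgA mulgV mul1g.
by rewrite e.
Qed.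

Lemma right_partX g k : right_part g -> right_part (tx 0 ^- k * g * tx 0 ^+ k).
Proof.
move=> cg; elim: k => [|k IH]; first by rewrite expg0 invg1 mul1g mulg1.
have := right_partJ IH; congr right_part.
by rewrite expgSr invgM !mulgA.
Qed.

Lemma right_part_true j : (0 < j)%N -> right_part (cls [:: (j, true)]).
Proof. by move=> j0; rewrite cls_true; apply/right_partV/right_part_tx. Qed.

Lemma right_part_word w : all (fun a : letter nat => (0 < a.1)%N && a.2) w ->
  right_part (cls w).
Proof.
elim: w => [_ D _|[i b] w IH /= /andP[/andP[/= i0 b1] hw]]; first exact: commute1.
rewrite -cat1s -clsM; apply: right_partM; last exact: IH.
by rewrite b1; apply: right_part_true.
Qed.

(** Each block is a product of letters of positive index conjugated by a
    power of x_0. *)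
Lemma right_part_block_words n K b : (0 < n)%N ->
  right_part (cls (block_words n K b) * tx 0 ^+ b).
Proof.
move=> n0; elim: b => [|b IH]; first by rewrite mulg1 => D _; apply: commute1.
rewrite /block_words /= -/(block_words n K b) /block_word catA -!clsM cls_true.
have -> : cls (rcomb n) * cls (lcomb K) * (tx 0)^-1 *
    cls (block_words n K b) * tx 0 ^+ b.+1 =
    cls (rcomb n ++ lcomb K) * ((tx 0)^-1 * (cls (block_words n K b) * tx 0 ^+ b) * tx 0).
  by rewrite expgSr -clsM !mulgA.
apply: right_partM; last exact: right_partJ.
apply: right_part_word; rewrite all_cat all_nseq orbT andbT.
by elim: (n).
Qed.

(** The work on the left and the work on the right are independent, which
    is why x and y have representatives in both orders. *)
Lemma right_word_commute n K B D : (0 < n)%N -> (2 <= D)%N ->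
  commute (cls (left_word D)) (cls (right_word n K B ++ up B)).
Proof.
move=> n0 D2; rewrite -clsM cls_up /right_word -clsM.
have -> : cls (block_words n K B) * cls [:: (n, true)] * tx 0 ^+ B =
  (cls (block_words n K B) * tx 0 ^+ B) *
  (tx 0 ^- B * cls [:: (n, true)] * tx 0 ^+ B).
  by rewrite !mulgA mulgK.
apply: right_partM D2; first exact: right_part_block_words.
exact/right_partX/right_part_true.
Qed.

Lemma word_y_eq n K B D : (0 < n)%N -> (2 <= D)%N -> (0 < B)%N ->
  cls (word_y n K B D) = cls (word_x n K B D) * cls (dn 2).
Proof.
move=> n0 D2 B0.
have upB : up B = up (B - 1) ++ up 1 by rewrite /up -nseqD; congr nseq; lia.
have upBD : up (B + D) = up B ++ up D by rewrite /up -nseqD.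
have dnD : dn (D - 1) = dn (D - 2) ++ dn 1 by rewrite /dn -nseqD; congr nseq; lia.
have e : cls (word_y n K B D) * cls (up 1) = cls (word_x n K B D) * cls (dn 1).
  have -> : cls (word_y n K B D) * cls (up 1) =
      cls (left_word D) * cls (right_word n K B ++ up B).
    by rewrite !clsM /word_y upB !catA.
  have -> : cls (word_x n K B D) * cls (dn 1) =
      cls (right_word n K B ++ up B) * cls (left_word D).
    by rewrite !clsM /word_x upBD /left_word dnD -!catA.
  exact: right_word_commute.
have -> : dn 2 = dn 1 ++ dn 1 by [].
by rewrite -clsM mulgA -e -mulgA linv_cls mulg1.
Qed.

Theorem theorem6p1 (n : nat) (n_gt0 : (0 < n)%N) : ~ almost_convex (X_ n_gt0).
Proof.
(* A path of length L can remove L carets and bring L points nearer. *)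
case=> L ac; pose D := L.+2; pose B := (n + L).+1.
pose m := (2 * D + B * (n + L + 1 + 1))%N.
pose x := cls (word_x n L B D); pose y := cls (word_y n L B D).
have KL : (L <= L)%N by [].
have DL : (L.+2 <= D)%N by [].
have BL : (n + L < B)%N by [].
have D2 : (2 <= D)%N by [].
have yE : y = x * cls (dn 2) by apply: word_y_eq.
have sx : size (word_x n L B D) = m by apply: size_word_x.
have sy : size (word_y n L B D) = m by apply: size_word_y.
have xb : in_ball (X_ n_gt0) m x.
  by apply/in_ballP; exists (word_x n L B D); rewrite sx letters_word_x.
have yb : in_ball (X_ n_gt0) m y.
  by apply/in_ballP; exists (word_y n L B D); rewrite sy letters_word_y.
have xy : (word_dist (X_ n_gt0) x y <= 2)%N by rewrite yE word_dist_le.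
have m0 : (0 < m)%N by rewrite /m.
have [p [pp lp sp pb]] := ac m m0 x y xb yb xy.
pose NR := near rat n L B D L; pose RL := right_first rat n L B D.
have nearE w u : letters_le n u -> (size u <= L)%N ->
    cls w = x * cls u -> NR w.
  move=> un uL; rewrite clsM => /cls_act e; exists u; split=> // q.
  by rewrite e actw_cat.
have conflict w1 w2 : letters_le n w1 -> NR w1 -> RL w1 ->
    left_first rat n L B D w2 -> cls w1 = cls w2 ->
    (2 * m + 2 <= size w1 + size w2)%N.
  by move=> h1 h2 h3 h4 /cls_act h5; apply: (ridge n_gt0 KL DL BL h1 h2 h3 h4).
(* The path cannot pass from right first to left first inside the ball. *)
have walk p' h u : letters_le n u -> h = x * cls u -> (size u + size p' <= L)%N ->
    path (cayley_edge (X_ n_gt0)) h p' -> all (in_ball (X_ n_gt0) m) p' ->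
    (exists w, [/\ letters_le n w, (size w <= m)%N, cls w = h, NR w & RL w]) ->
    exists w, [/\ letters_le n w, (size w <= m)%N, cls w = last h p', NR w & RL w].
  elim: p' h u => [|g p' IH] h u //= un hE uL /andP[/cayley_edgeP[a an gE] gp]
    /andP[/in_ballP[w [wn wm wg]] bp] [w1 [w1n w1m w1h w1N w1R]].
  have ruE : g = x * cls (rcons u a) by rewrite -cats1 -clsM mulgA -hE.
  have run : letters_le n (rcons u a) by rewrite /letters_le all_rcons an.
  apply: (IH g (rcons u a) run ruE) => //; first by rewrite size_rcons addSnnS.
  have wN : NR w.
    by apply: (nearE w (rcons u a) run); [rewrite size_rcons; lia | rewrite wg].
  exists w; split=> //.
  case: (near_right_or_left_first n_gt0 KL DL BL wn wN) => // -[T [T' [h1 h2 h3]]].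
  have : (2 * m + 2 <= size w1 + size (w ++ [:: linv a]))%N.
    apply: conflict => //; last first.
      by rewrite -clsM wg gE -mulgA linv_cls mulg1.
    by apply: left_first_cat; exists T, T'.
  by clear -w1m wm; rewrite size_cat /=; lia.
have [] := walk p x [::] isT _ sp pp.
- by rewrite -[x in LHS]mulg1.
- by case/andP: pb.
- exists (word_x n L B D); split; rewrite ?sx ?letters_word_x //;
    last exact: word_x_right_first BL.
  by apply: (nearE _ [::]); rewrite // mulg1.
move=> w1 [w1n w1m w1y w1N w1R].
have := conflict w1 (word_y n L B D) w1n w1N w1R (word_y_left_first rat n_gt0 KL DL BL).
by rewrite w1y lp => /(_ erefl); rewrite sy; lia.
Qed.
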